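(* Let $V=\mathbb R^{p,q}\neq0$, let $S$ be its spinor module with Schur algebra $\mathcal C$ and canonical bilinear form $h$ (see context). Every $\mathfrak{so}(V)$-equivariant linear map $j:V\to(S\otimes S)^*$ is a linear combination of the embeddings $j_A=j_\rho(h_A)$, $$j_A(v)=h(A\rho(v)\,\cdot\,,\,\cdot\,),\qquad h_A=h(A\,\cdot\,,\,\cdot\,),$$ where $A$ are admissible elements of $\mathcal C$.
   Context: Clifford algebras use $v^2=-\langle v,v\rangle$. The spinor module $S$ of $V$ is an irreducible real $C\ell(V)$-module, $\rho(v)$ is Clifford multiplication, $\mathcal C$ is the algebra of $\mathfrak{so}(V)$-invariant endomorphisms of $S$. If $S$ is reducible over $C\ell^0(V)$, write $S=S^++S^-$ with irreducible $C\ell^0(V)$-submodules, $S^-=C\ell^1(V)S^+$. For a bilinear form $\beta$, $j_\rho(\beta)(v)=\beta(\rho(v)\cdot,\cdot)$. Canonical form: write $V=V_1+V_2$ orthogonally with $V_1=\mathbb R^{m,m}$ and $V_2$ positive or negative definite. On the spinor module $S_2$ of $V_2\ne0$ let $h_2$ be the positive definite scalar product invariant under Clifford multiplication by unit vectors (unique up to scale). The spinor module of $V_1=\mathbb R^{m,m}=U+U^*$ ($U,U^*$ complementary isotropic, dual via $u^*(u)=\langle u,u^*\rangle$) is $S_1=\wedge U$ with $\rho(u)s=u\wedge s$, $\rho(u^* )s=-2u^*\angle s$ (interior multiplication), $S_1^+=\wedge^{ev}U$, $S_1^-=\wedge^{odd}U$; $E|S_1^\pm=\pm\mathrm{Id}$;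 with $0\ne vol\in\wedge^mU$, $f(\wedge^iU,\wedge^jU)=0$ if $i+j\neq m$, $f(s,t)vol=(-1)^{i(i+1)/2}s\wedge t$ for $s\in\wedge^iU,t\in\wedge^{m-i}U$; $f_E=f(E\cdot,\cdot)$. For $V_1,V_2\neq0$, $S=S_1\otimes S_2$ with $(v_1+v_2)(s_1\otimes s_2)=v_1s_1\otimes s_2+(-1)^{\deg s_1}s_1\otimes v_2s_2$, and $h=h_1\otimes h_2$, where $h_1\in\{f,f_E\}$ is the one with $\tau(h_2)=\iota(h_1)\tau(h_1)$. If $V_1=0$, $h=h_2$; if $V_2=0$, $h=f_E$. Here for a bilinear form $\beta$ the sign $\tau(\beta)$ is defined by $\beta(\rho(v)s,t)=\tau(\beta)\beta(s,\rho(v)t)$ for all $v$, and $\iota(\beta)=+1$ if $S^+,S^-$ are $\beta$-orthogonal, $-1$ if both are $\beta$-isotropic. A nonzero endomorphism $A$ of $S$ is admissible if: (1) $A$ either commutes with all $\rho(v)$ or anticommutes with all $\rho(v)$; (2) $A$ is $h$-symmetric or $h$-skew symmetric; (3) if $S=S^++S^-$ is reducible, either $AS^\pm\subset S^\pm$ or $AS^\pm\subset S^\mp$. *)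

(* Defs.v *)
From HB Require Import structures.
From mathcomp Require Import all_boot all_order all_algebra.
From mathcomp Require Import reals.
Set Implicit Arguments.
Unset Strict Implicit.
Unset Printing Implicit Defensive.
Import Order.TTheory GRing.Theory Num.Theory.
Local Open Scope ring_scope.

(* (S ⊗ S)^* in curried form. *)
Notation bilform R S := 'Hom(S, 'Hom(S, R^o)).

(* The exterior algebra of R^m, an element being given by its coefficients on
   the basis e_I = e_(i1) /\ ... /\ e_(ik), where I = {i1 < ... < ik}. *)
Notation extalg R m := {ffun {set 'I_m} -> R^o}.

Section CliffordModules.
Variables (R : realType) (V S : vectType R) (g : V -> V -> R).
Implicit Types (rho : 'Hom(V, 'End(S))) (W : {vspace S}) (vs : seq V).

(* By the universal property of Cl(V, g), with the convention v^2 = - g v v,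
   a Cl(V, g)-module structure on S is a linear map rho as follows. *)
Definition clifford_module rho :=
  forall v, (rho v \o rho v)%VF = (- g v v) *: \1%VF.

Definition clprod rho vs : 'End(S) :=
  foldr (fun v B => (rho v \o B)%VF) \1%VF vs.

(* Cl^0(V) and Cl^1(V) are spanned by the products of an even, respectively
   odd, number of vectors, and Cl(V) by all the products of vectors. *)
Definition even_word vs := ~~ odd (size vs).
Definition odd_word vs := odd (size vs).

Definition submodule rho (P : pred (seq V)) W :=
  forall vs, P vs -> (clprod rho vs @: W <= W)%VS.

Definition irreducible_over rho (P : pred (seq V)) W :=
  [/\ W != 0%VS, submodule rho P W &
      forall W', (W' <= W)%VS -> submodule rho P W' -> W' = 0%VS \/ W' = W].

Definition spinor_module rho :=
  clifford_module rho /\ irreducible_over rho predT fullv.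

Definition Cl0_reducible rho := ~ irreducible_over rho even_word fullv.

(* Sm is the subspace Cl^1(V) Sp spanned by the images of Sp. *)
Definition is_Cl1_image rho Sp Sm :=
  (forall vs, odd_word vs -> (clprod rho vs @: Sp <= Sm)%VS) /\
  (forall W, (forall vs, odd_word vs -> (clprod rho vs @: Sp <= W)%VS) ->
     (Sm <= W)%VS).

Definition semispinor_decomposition rho Sp Sm :=
  [/\ (Sp + Sm)%VS = fullv, (Sp :&: Sm)%VS = 0%VS,
      irreducible_over rho even_word Sp, irreducible_over rho even_word Sm &
      is_Cl1_image rho Sp Sm].

Definition h_form (h : bilform R S) (A : 'End(S)) : bilform R S :=
  (h \o A)%VF.

Definition j_rho rho (beta : bilform R S) (v : V) : bilform R S :=
  (beta \o rho v)%VF.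

Definition admissible rho (h : bilform R S) Sp Sm (A : 'End(S)) :=
  [/\ A != 0,
      (forall v, (A \o rho v)%VF = (rho v \o A)%VF) \/
      (forall v, (A \o rho v)%VF = - (rho v \o A)%VF),
      (forall s t, h (A s) t = h s (A t)) \/
      (forall s t, h (A s) t = - h s (A t)) &
      Cl0_reducible rho ->
        ((A @: Sp <= Sp)%VS /\ (A @: Sm <= Sm)%VS) \/
        ((A @: Sp <= Sm)%VS /\ (A @: Sm <= Sp)%VS)].

Definition definite_on (W : {vspace V}) :=
  (forall v, v \in W -> v != 0 -> 0 < g v v) \/
  (forall v, v \in W -> v != 0 -> g v v < 0).

Definition invariant_scalar_product rho (h : bilform R S) :=
  [/\ forall s t, h s t = h t s, forall s, s != 0 -> 0 < h s s &
      forall v, g v v = 1 \/ g v v = -1 ->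
        forall s t, h (rho v s) (rho v t) = h s t].

End CliffordModules.

Section SplitSpinors.
Variables (R : realType) (m : nat).
Implicit Types (x y : 'rV[R]_m) (s t vol : extalg R m) (I K : {set 'I_m}).

(* e_I /\ e_J = (-1)^(ninv I J) e_(I :|: J) for disjoint I and J. *)
Definition ninv I K : nat :=
  #|[set ij : 'I_m * 'I_m | [&& ij.1 \in I, ij.2 \in K & (ij.2 < ij.1)%N]]|.

Definition wedge s t : extalg R m :=
  [ffun K : {set 'I_m} =>
     \sum_(I : {set 'I_m} | I \subset K)
        (-1) ^+ ninv I (K :\: I) * s I * t (K :\: I)].

Definition ext_vec x : extalg R m :=
  [ffun K : {set 'I_m} => \sum_i (K == [set i])%:R * x 0 i].

(* The antiderivation s |-> y ∠ s with y ∠ e_i = y_i; here y is a linear form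
   on R^m given by its coordinates in the dual basis. *)
Definition interior y s : extalg R m :=
  [ffun K : {set 'I_m} =>
     \sum_(i | i \notin K)
        (-1) ^+ #|[set k in K | (k < i)%N]| * y 0 i * s (i |: K)].

(* Clifford multiplication by x + y, with x in U = R^m and y in U^*. *)
Definition split_clifford (xy : 'rV[R]_m * 'rV[R]_m) s : extalg R m :=
  wedge (ext_vec xy.1) s - (2%:R : R) *: interior xy.2 s.

Definition homogeneous (i : nat) s := forall I, s I != 0 -> #|I| = i.
Definition even_spinor s := forall I, s I != 0 -> ~~ odd #|I|.
Definition odd_spinor s := forall I, s I != 0 -> odd #|I|.

Definition grading s : extalg R m :=
  [ffun I : {set 'I_m} => (-1) ^+ #|I| * s I].

Definition component (i : nat) s : extalg R m :=
  [ffun I : {set 'I_m} => if #|I| == i then s I else 0].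

(* For s of degree i and t of degree m - i, s /\ t is a multiple of vol, the
   factor being the quotient of their coefficients on e_1 /\ ... /\ e_m. *)
Definition split_f vol s t : R :=
  \sum_(i < m.+1)
     (-1) ^+ (i * i.+1)./2 *
     (wedge (component i s) (component (m - i) t) [set: 'I_m]
        / vol [set: 'I_m]).

Definition split_fE vol s t : R := split_f vol (grading s) t.

Definition has_iota (beta : extalg R m -> extalg R m -> R) (e : R) :=
  (e = 1 /\ forall s t, even_spinor s -> odd_spinor t ->
              beta s t = 0 /\ beta t s = 0) \/
  (e = -1 /\ forall s t, (even_spinor s /\ even_spinor t) \/
                         (odd_spinor s /\ odd_spinor t) -> beta s t = 0).

(* The tensor product of extalg R m with S2 is {ffun {set 'I_m} -> S2}. *)
Definition tens (S2 : vectType R) s (s2 : S2) : {ffun {set 'I_m} -> S2} :=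
  [ffun I : {set 'I_m} => (s I : R) *: s2].

End SplitSpinors.

Definition has_tau (R : realType) (V S : Type) (act : V -> S -> S)
    (beta : S -> S -> R) (e : R) :=
  (e = 1 \/ e = -1) /\
  forall v s t, beta (act v s) t = e * beta s (act v t).

Section CanonicalForm.
Variables (R : realType) (V S : vectType R) (g : V -> V -> R).
Variables (rho : 'Hom(V, 'End(S))) (h : bilform R S).

(* V is the orthogonal sum of V1 = U + U^* and V2; iU and iU' identify R^m and
   its dual with the isotropic subspaces U and U^* of V. *)
Definition orthogonal_splitting m (iU iU' : 'Hom('rV[R]_m, V))
    (V2 : {vspace V}) :=
  [/\ forall x y, g (iU x) (iU y) = 0,
      forall x y, g (iU' x) (iU' y) = 0,
      forall x y, g (iU x) (iU' y) = \sum_i x 0 i * y 0 i,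
      forall x w, w \in V2 -> g (iU x) w = 0 /\ g (iU' x) w = 0 &
      (limg iU + limg iU' + V2)%VS = fullv].

Definition volume_form m (vol : extalg R m) := vol != 0 /\ homogeneous m vol.

Definition canonical_definite :=
  definite_on g fullv /\ invariant_scalar_product g rho h.

Definition canonical_split :=
  exists (m : nat) (iU iU' : 'Hom('rV[R]_m, V)) (vol : extalg R m)
         (phi : 'Hom(extalg R m, S)),
    [/\ orthogonal_splitting iU iU' 0%VS,
        volume_form vol,
        lker phi = 0%VS /\ limg phi = fullv,
        forall x y s,
          rho (iU x + iU' y) (phi s) = phi (split_clifford (x, y) s) &
        forall s t, h (phi s) (phi t) = split_fE vol s t].

Definition canonical_mixed :=
  exists (m : nat) (iU iU' : 'Hom('rV[R]_m, V)) (V2 : {vspace V})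
         (S2 : vectType R) (rho2 : 'Hom(subvs_of V2, 'End(S2)))
         (h2 : bilform R S2) (vol : extalg R m)
         (h1 : extalg R m -> extalg R m -> R)
         (tau1 iota1 tau2 : R)
         (phi : 'Hom({ffun {set 'I_m} -> S2}, S)),
    let g2 := fun v w : subvs_of V2 => g (vsval v) (vsval w) in
    [/\ [/\ (0 < m)%N, V2 != 0%VS, definite_on g V2 &
            orthogonal_splitting iU iU' V2],
        spinor_module g2 rho2 /\ invariant_scalar_product g2 rho2 h2,
        [/\ volume_form vol,
            h1 = split_f vol \/ h1 = split_fE vol,
            has_tau (@split_clifford R m) h1 tau1,
            has_iota h1 iota1 &
            has_tau (fun v => rho2 v) (fun s t => h2 s t) tau2 /\
            tau2 = iota1 * tau1],
        [/\ lker phi = 0%VS, limg phi = fullv &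
            forall x y (w : subvs_of V2) i s1 s2, homogeneous i s1 ->
              rho (iU x + iU' y + vsval w) (phi (tens s1 s2)) =
                phi (tens (split_clifford (x, y) s1) s2)
                + (-1) ^+ i *: phi (tens s1 (rho2 w s2))] &
        forall s1 s2 t1 t2,
          h (phi (tens s1 s2)) (phi (tens t1 t2)) = h1 s1 t1 * h2 s2 t2].

(* The cases V1 = 0, V2 = 0, and V1, V2 both nonzero. *)
Definition canonical_form :=
  [\/ canonical_definite, canonical_split | canonical_mixed].

End CanonicalForm.

Section PseudoEuclidean.
Variables (R : realType) (p q : nat).
Local Notation V := 'rV[R]_(p + q).

Definition pseudo_euclidean (v w : V) : R :=
  \sum_(i < p + q) (if (i < p)%N then 1 else -1) * v 0 i * w 0 i.

Definition so (a : 'End(V)) :=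
  forall v w, pseudo_euclidean (a v) w + pseudo_euclidean v (a w) = 0.

Variables (S : vectType R) (rho : 'Hom(V, 'End(S))).

(* The image of a under so(V) = spin(V) in Cl^0(V): for a in so(V) this is the
   element a' of the span of the [rho v, rho w] with [a', rho x] = rho (a x). *)
Definition spin_rep (a : 'End(V)) : 'End(S) :=
  4%:R^-1 *: \sum_(i < p + q)
    pseudo_euclidean (delta_mx 0 i) (delta_mx 0 i) *:
      (rho (delta_mx 0 i) \o rho (a (delta_mx 0 i)))%VF.

Definition schur_algebra (A : 'End(S)) :=
  forall a, so a -> (A \o spin_rep a)%VF = (spin_rep a \o A)%VF.

Definition so_equivariant (j : V -> bilform R S) :=
  forall a, so a -> forall v s t,
    j (a v) s t = - j v (spin_rep a s) t - j v s (spin_rep a t).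

End PseudoEuclidean.

(* Main.v *)
Require Import Defs.
From HB Require Import structures.
From mathcomp Require Import all_boot all_order all_algebra.
From mathcomp Require Import reals boolp ring lra zify.
From mathcomp Require complex.
Set Implicit Arguments.
Unset Strict Implicit.
Unset Printing Implicit Defensive.
Import Order.TTheory GRing.Theory Num.Theory.
Local Open Scope ring_scope.

(** Since [h] is nondegenerate and [so(V)]-invariant, an equivariant map from
    [V] to the bilinear forms on [S] is [v |-> h (b v s) t] for an equivariant
    linear map [b] from [V] to [End S]. Let [w = e_1 e_j]. The infinitesimal
    rotation in the plane of [e_1] and [e_j], applied to [b e_1] and to [b e_j],
    shows that [b e_1] anticommutes with [w] and that [b e_j] is a multiple of
    [b e_1 \o w]. Hence [b v = A \o rho v] for a single [A], which commutes with
    all the products [e_1 e_j], that is, with the even Clifford algebra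
    ([equivariant_operator]).

    Such an [A] is a sum of admissible elements. Conjugation by [e_1] splits it
    into a part commuting and a part anticommuting with Clifford multiplication
    ([admissible_sum_even]); each of these splits into an [h]-symmetric and an
    [h]-skew part ([admissible_sum_commutes]); when [S] is reducible over the
    even Clifford algebra, conjugation by the grading [E] of [Sp] and [Sm]
    splits these once more ([admissible_sum_selfadjoint]). The last splitting
    respects the previous one because [E] is itself [h]-symmetric or [h]-skew,
    for every semispinor decomposition: [E] composed with its adjoint is a
    selfadjoint element of the commutant of the Clifford algebra, hence a
    scalar, which can only be [1] or [-1] ([grading_adjoint]).

    The properties of [h] used here are collected in [clifford_form]. That the
    selfadjoint elements of the commutant are scalars comes from positivity: in
    the definite case [h] is a scalar product, and in the other cases the
    commutant acts on the second factor of [S_1 (x) S_2], where [h_2] is a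
    scalar product ([tensor_commutant]). So such an element has a real
    eigenvalue, and by Schur's lemma it is a scalar. The symmetry of [f] and
    [f_E], and the sign of [f_E] in the split case, are computed on the basis
    of the exterior algebra.

    Conversely, the embedding of an admissible [A] is equivariant since [A]
    commutes with [so(V)] and [h] is invariant, and it is injective since [A] is
    invertible and [rho] is injective. *)

(** * Linear and bilinear algebra *)

Section LinearMaps.
Variables (R : nzRingType) (U W : vectType R) (f : 'Hom(U, W)).

(** Linearity of an element of ['Hom] and of a bilinear form, stated on
    applications so that they can be used as rewrite rules. *)
Lemma happD x y : f (x + y) = f x + f y. Proof. exact: linearD. Qed.
Lemma happN x : f (- x) = - f x. Proof. exact: linearN. Qed.
Lemma happB x y : f (x - y) = f x - f y. Proof. exact: linearB. Qed.
Lemma happZ a x : f (a *: x) = a *: f x. Proof. exact: linearZ. Qed.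
Lemma happ0 : f 0 = 0. Proof. exact: linear0. Qed.
Lemma happ_sum I (r : seq I) (F : I -> U) :
  f (\sum_(i <- r) F i) = \sum_(i <- r) f (F i).
Proof. exact: linear_sum. Qed.

Definition happE := (happD, happN, happZ, happ0).
End LinearMaps.

Section Bilform.
Variables (R : realType) (S : vectType R) (h : bilform R S).

Lemma bilDl s s' t : h (s + s') t = h s t + h s' t.
Proof. by rewrite linearD add_lfunE. Qed.

Lemma bilNl s t : h (- s) t = - h s t.
Proof. by rewrite linearN opp_lfunE. Qed.

Lemma bilZl a s t : h (a *: s) t = a * h s t.
Proof. by rewrite linearZ scale_lfunE. Qed.

Lemma bilDr s t t' : h s (t + t') = h s t + h s t'.
Proof. exact: linearD. Qed.

Lemma bilNr s t : h s (- t) = - h s t.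
Proof. exact: linearN. Qed.

Lemma bilZr a s t : h s (a *: t) = a * h s t.
Proof. exact: linearZ. Qed.

Lemma bil0l t : h 0 t = 0.
Proof. by rewrite linear0 zero_lfunE. Qed.

Lemma bil0r s : h s 0 = 0.
Proof. exact: linear0. Qed.

Lemma bil_suml I (r : seq I) (F : I -> S) t :
  h (\sum_(i <- r) F i) t = \sum_(i <- r) h (F i) t.
Proof. by rewrite linear_sum sum_lfunE. Qed.

Lemma bil_sumr I (r : seq I) (F : I -> S) s :
  h s (\sum_(i <- r) F i) = \sum_(i <- r) h s (F i).
Proof. exact: linear_sum. Qed.

Definition bilE := (bilDl, bilDr, bilNl, bilNr, bilZl, bilZr, bil0l, bil0r).
End Bilform.

(** A linear function between vector spaces is an element of ['Hom]. *)
Lemma linear_hom (R : nzRingType) (U W : vectType R) (f : U -> W) :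
  linear f -> exists F : 'Hom(U, W), forall x, F x = f x.
Proof.
move=> lf; pose L : {linear U -> W} := HB.pack f
  (GRing.isLinear.Build R U W _ f lf).
by exists (linfun L) => x; rewrite lfunE.
Qed.

Section RealEigenvalues.
Import complex VectorInternalTheory.

(** An endomorphism of a nonzero real vector space has a complex eigenvector
    [s + i t], of eigenvalue [a + i b]. *)
Lemma complex_eigenpair (R : rcfType) (S : vectType R) (Z : 'End(S)) :
  (fullv : {vspace S}) != 0%VS ->
  exists (a b : R) (s t : S), [/\ (s != 0) || (t != 0),
    Z s = a *: s - b *: t & Z t = b *: s + a *: t].
Proof.
move=> S0.
have d0 : (0 < dim S)%N by rewrite -dimvf lt0n dimv_eq0.
pose f : 'rV[R]_(dim S) -> 'rV[R]_(dim S) := v2r \o Z \o r2v.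
pose M := lin1_mx f.
have [a /eigenvalueP [w wM w0]] :=
  eigenvalue_closed (map_mx (real_complex R) M) d0.
pose u := map_mx (@complex.Re R) w; pose v := map_mx (@complex.Im R) w.
have Zf x : Z (r2v x) = r2v (x *m M) by rewrite mul_rV_lin1 /f /= v2rK.
have key j : \sum_i w 0 i * (M i j)%:C%C = a * w 0 j.
  move/rowP/(_ j): wM; rewrite !mxE => <-.
  by apply: eq_bigr => i _; rewrite !mxE.
exists (complex.Re a), (complex.Im a), (r2v u), (r2v v); split.
- rewrite !(raddf_eq0 _ (@r2v_inj R S)).
  apply: contraNT w0; rewrite negb_or !negbK => /andP [/eqP u0 /eqP v0].
  apply/eqP/rowP => j; rewrite mxE.
  move/rowP/(_ j): u0; move/rowP/(_ j): v0; rewrite !mxE.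
  by case: (w 0 j) => x y /= -> ->.
- rewrite Zf -!linearZ -linearB; congr r2v; apply/rowP => j.
  rewrite !mxE; move/(congr1 (@complex.Re R)): (key j); rewrite raddf_sum /=.
  case: (a) (w 0 j) => [x y] [x' y'] /= <-.
  by apply: eq_bigr => i _; rewrite mxE; case: (w 0 i) => ? ? /=;
    rewrite mulr0 subr0.
- rewrite Zf -!linearZ -linearD; congr r2v; apply/rowP => j.
  rewrite !mxE; move/(congr1 (@complex.Im R)): (key j); rewrite raddf_sum /=.
  case: (a) (w 0 j) => [x y] [x' y'] /=; rewrite addrC => <-.
  by apply: eq_bigr => i _; rewrite mxE; case: (w 0 i) => ? ? /=;
    rewrite mulr0 add0r.
Qed.
End RealEigenvalues.

(** Symmetry of [Z] on the complex eigenvector [s + i t] gives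
    [b (h s s + h t t) = 0], so the eigenvalue is real. *)
Lemma selfadjoint_eigenvector (R : realType) (S : vectType R)
    (h : bilform R S) (Z : 'End(S)) :
  (fullv : {vspace S}) != 0%VS ->
  (forall s t, h s t = h t s) -> (forall s, s != 0 -> 0 < h s s) ->
  (forall s t, h (Z s) t = h s (Z t)) ->
  exists (a : R) (s : S), s != 0 /\ Z s = a *: s.
Proof.
move=> S0 hsym hpos hZ.
have [a [b [s [t [st0 Zs Zt]]]]] := complex_eigenpair Z S0.
have hge x : 0 <= h x x.
  by have [->|/hpos/ltW //] := eqVneq x 0; rewrite linear0.
have b0 : b = 0.
  have := hZ s t; rewrite Zs Zt !bilE => e.
  have : b * (h s s + h t t) = 0 by move: (h s s) (h t t) (h s t) e => *; lra.
  move/eqP; rewrite mulf_eq0 => /orP [/eqP //|].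
  rewrite paddr_eq0 // => /andP [hs ht].
  case/orP: st0 => /hpos; first by rewrite (eqP hs) ltxx.
  by rewrite (eqP ht) ltxx.
rewrite b0 !scale0r subr0 in Zs; rewrite b0 !scale0r add0r in Zt.
by case/orP: st0 => x0; [exists a, s | exists a, t].
Qed.

(** * The scalar product of V and Clifford modules *)

Section ScalarProduct.
Variables (R : realType) (p q : nat).
Local Notation V := 'rV[R]_(p + q).
Local Notation g := (@pseudo_euclidean R p q).
Local Notation e i := (delta_mx 0 i : V).
Implicit Types (v w x : V) (i j : 'I_(p + q)).

(** The scalar square, [1] or [-1], of the [i]-th standard basis vector. *)
Definition basis_norm i : R := if (i < p)%N then 1 else -1.

Lemma basis_norm_sq i : basis_norm i * basis_norm i = 1.
Proof. by rewrite /basis_norm; case: ifP => _; ring. Qed.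

Lemma pseudo_euclideanC v w : g v w = g w v.
Proof. by apply: eq_bigr => i _; ring. Qed.

Lemma pseudo_euclideanDl v v' w : g (v + v') w = g v w + g v' w.
Proof.
by rewrite -big_split; apply: eq_bigr => i _ /=; rewrite mxE; ring.
Qed.

Lemma pseudo_euclidean_basis i v : g (e i) v = basis_norm i * v 0 i.
Proof.
rewrite /pseudo_euclidean (bigD1 i) //= big1 ?addr0 => [|k ki].
  by rewrite mxE !eqxx mulr1.
by rewrite mxE (negPf ki) andbF mulr0 mul0r.
Qed.

Lemma pseudo_euclidean_basis2 i j :
  g (e i) (e j) = basis_norm i * (i == j)%:R.
Proof. by rewrite pseudo_euclidean_basis mxE eqxx eq_sym. Qed.

Lemma pseudo_euclidean_expand v : \sum_i (g (e i) (e i) * g (e i) v) *: e i = v.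
Proof.
rewrite {2}[v]row_sum_delta; apply: eq_bigr => i _.
rewrite !pseudo_euclidean_basis mxE !eqxx mulr1 mulrA basis_norm_sq.
by rewrite mul1r.
Qed.

(** The rotation generator of the plane spanned by [e i] and [e j]. *)
Definition plane_rotation i j v : V :=
  (basis_norm i * v 0 i) *: e j - (basis_norm j * v 0 j) *: e i.

Lemma plane_rotation_is_linear i j : linear (plane_rotation i j).
Proof.
move=> a v w; apply/rowP => k; rewrite !mxE; ring.
Qed.
HB.instance Definition _ i j :=
  GRing.isLinear.Build R V V _ (plane_rotation i j)
    (plane_rotation_is_linear i j).

Lemma plane_rotation_so i j : so (linfun (plane_rotation i j)).
Proof.
move=> v w; rewrite !lfunE /= /plane_rotation.
have gZ a x y : g (a *: x) y = a * g x y.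
  by rewrite mulr_sumr; apply: eq_bigr => k _; rewrite mxE; ring.
rewrite [g v _]pseudo_euclideanC -!scaleNr !pseudo_euclideanDl !gZ.
by rewrite !pseudo_euclidean_basis; ring.
Qed.

End ScalarProduct.

(** [A] commutes ([c = 1]) or anticommutes ([c = -1]) with the Clifford
    multiplications. *)
Definition sign_commutes (R : realType) (V S : vectType R)
    (rho : 'Hom(V, 'End(S))) (c : R) (A : 'End(S)) :=
  forall v s, A (rho v s) = c *: rho v (A s).

Section IrreducibleModule.
Variables (R : realType) (V S : vectType R) (rho : 'Hom(V, 'End(S))).
Hypothesis irr : irreducible_over rho predT fullv.

Lemma spinors_neq0 : (fullv : {vspace S}) != 0%VS.
Proof. by case: irr. Qed.

Lemma stable_subspace (W : {vspace S}) :
  (forall v s, s \in W -> rho v s \in W) -> W = 0%VS \/ W = fullv.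
Proof.
move=> stW; case: irr => _ _; apply; first exact: subvf.
move=> vs _; apply/subvP => x /memv_imgP [s sW ->].
elim: vs => [|v vs IH] /=; first by rewrite id_lfunE.
by rewrite comp_lfunE; apply: stW.
Qed.

(** Schur's lemma: the kernel of such an [A] is a submodule. *)
Lemma sign_commutes_eq0 c A s :
  sign_commutes rho c A -> s != 0 -> A s = 0 -> A = 0.
Proof.
move=> cA s0 As0; case: (@stable_subspace (lker A)).
- by move=> v x; rewrite !memv_ker cA => /eqP ->; rewrite linear0 scaler0.
- move=> k0; move: s0; suff: s \in lker A by rewrite k0 memv0 => ->.
  by rewrite memv_ker As0.
- move=> kT; apply/lfunP => x; apply/eqP; rewrite zero_lfunE -memv_ker kT.
  exact: memvf.
Qed.

(** An element of the commutant with a real eigenvalue is a scalar. *)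
Lemma commutant_eigenvector Z a s0 : sign_commutes rho 1 Z -> s0 != 0 ->
  Z s0 = a *: s0 -> forall s, Z s = a *: s.
Proof.
move=> cZ s00 Zs0 s; have ZaE t : (Z - a *: \1%VF) t = Z t - a *: t.
  by rewrite add_lfunE opp_lfunE scale_lfunE id_lfunE.
have cZa : sign_commutes rho 1 (Z - a *: \1%VF).
  by move=> v t; rewrite !ZaE cZ !scale1r happB happZ.
have Za0 : Z - a *: \1%VF = 0.
  by apply: (sign_commutes_eq0 cZa s00); rewrite ZaE Zs0 subrr.
by apply/eqP; rewrite -subr_eq0 -ZaE Za0 zero_lfunE.
Qed.

(** The kernel of a form with a sign is a submodule, so a nonzero one is
    nondegenerate. *)
Lemma form_nondegenerate (h : bilform R S) (tau : R) :
  (forall v s t, h (rho v s) t = tau * h s (rho v t)) ->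
  (exists s t, h s t != 0) -> forall s, (forall t, h s t = 0) -> s = 0.
Proof.
move=> htau [s0 [t0 h0]]; case: (@stable_subspace (lker h)).
- move=> v x; rewrite !memv_ker => /eqP hx; apply/eqP/lfunP => t.
  by rewrite htau hx !zero_lfunE mulr0.
- move=> k0 s hs; apply/eqP; rewrite -memv0 -k0 memv_ker.
  by apply/eqP/lfunP => t; rewrite hs zero_lfunE.
- move=> kT; have : s0 \in lker h by rewrite kT memvf.
  by rewrite memv_ker => /eqP hs0; rewrite hs0 zero_lfunE eqxx in h0.
Qed.

End IrreducibleModule.

(** The properties of the canonical form on which the argument rests: it has
    the sign [tau] with respect to Clifford multiplication, it is symmetric
    ([eps = 1]) or skew ([eps = -1]), it is nondegenerate, and the selfadjoint
    elements of the commutant of the Clifford algebra are scalars. *)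
Record clifford_form (R : realType) (V S : vectType R)
    (rho : 'Hom(V, 'End(S))) (h : bilform R S) (tau eps : R) := CliffordForm {
  form_tau_sq : tau * tau = 1;
  form_tau : forall v s t, h (rho v s) t = tau * h s (rho v t);
  form_eps_sq : eps * eps = 1;
  form_sym : forall s t, h s t = eps * h t s;
  form_nondeg : forall s, (forall t, h s t = 0) -> s = 0;
  form_scalar : forall Z, sign_commutes rho 1 Z ->
    (forall s t, h (Z s) t = h s (Z t)) -> exists a, forall s, Z s = a *: s }.

Section Algebra.
Variables (R : realType) (p q : nat).
Local Notation V := 'rV[R]_(p + q).
Local Notation g := (@pseudo_euclidean R p q).
Local Notation e i := (delta_mx 0 i : V).
Variables (S : vectType R) (rho : 'Hom(V, 'End(S))).
Hypothesis hS : spinor_module g rho.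
Variables (h : bilform R S) (tau eps : R).
Hypothesis hf : clifford_form rho h tau eps.
Implicit Types (v w x : V) (s t : S) (A B Z : 'End(S)).

Let irr := hS.2.

(** Vectors are compared by pairing them with all [t], which turns vector
    identities into identities of real numbers. *)
Lemma form_inj s s' : (forall t, h s t = h s' t) -> s = s'.
Proof.
move=> hss'; apply/eqP; rewrite -subr_eq0; apply/eqP/(form_nondeg hf) => t.
by rewrite !bilE hss' subrr.
Qed.

Lemma clifford_sq v s : rho v (rho v s) = (- g v v) *: s.
Proof.
by have /lfunP/(_ s) := hS.1 v; rewrite comp_lfunE scale_lfunE id_lfunE.
Qed.

Lemma clifford_polar v w s :
  rho v (rho w s) = - rho w (rho v s) - (2 * g v w) *: s.
Proof.
apply: form_inj => t; have := clifford_sq (v + w) s.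
move/(congr1 (fun y : S => h y t)).
rewrite (linearD rho) !add_lfunE !linearD !add_lfunE /= !clifford_sq.
rewrite !pseudo_euclideanDl ![g _ (v + w)]pseudo_euclideanC.
rewrite !pseudo_euclideanDl (pseudo_euclideanC w v) !bilE.
move: (h (rho v (rho w s)) t) (h (rho w (rho v s)) t) => *; lra.
Qed.

Lemma spin_repE (a : 'End(V)) s : spin_rep rho a s =
  4^-1 *: \sum_i g (e i) (e i) *: rho (e i) (rho (a (e i)) s).
Proof.
rewrite scale_lfunE sum_lfunE; congr (_ *: _); apply: eq_bigr => i _.
by rewrite scale_lfunE comp_lfunE.
Qed.

(** The commutator with the image of [a] in the Clifford algebra acts on
    vectors as [a]. *)
Lemma spin_rep_commutator (a : 'End(V)) v s : so a ->
  rho (a v) s = spin_rep rho a (rho v s) - rho v (spin_rep rho a s).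
Proof.
move=> soa; rewrite !spin_repE linearZ /= -scalerBr linear_sum -sumrB.
have -> : rho (a v) s = 4^-1 *: (2 *: rho (a v) s + 2 *: rho (a v) s).
  by apply: form_inj => t; rewrite !bilE; field.
congr (_ *: _).
have {1}-> : rho (a v) s =
    \sum_i (g (e i) (e i) * - g (a (e i)) v) *: rho (e i) s.
  rewrite -{1}[a v]pseudo_euclidean_expand !linear_sum sum_lfunE.
  apply: eq_bigr => i _; rewrite linearZ scale_lfunE; congr (_ * _ *: _).
  by apply/eqP; rewrite -addr_eq0 addrC soa.
have -> : rho (a v) s = \sum_i (g (e i) (e i) * g (e i) v) *: rho (a (e i)) s.
  rewrite -{1}[v]pseudo_euclidean_expand !linear_sum sum_lfunE.
  by apply: eq_bigr => i _; rewrite !linearZ scale_lfunE.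
rewrite !scaler_sumr -big_split; apply: eq_bigr => i _ /=.
have -> : rho (e i) (rho (a (e i)) (rho v s)) =
    rho v (rho (e i) (rho (a (e i)) s))
    + (2 * g (e i) v) *: rho (a (e i)) s - (2 * g (a (e i)) v) *: rho (e i) s.
  rewrite (clifford_polar (a (e i))) !happE.
  rewrite (clifford_polar (e i) v (rho (a (e i)) s)).
  by apply: form_inj => t; rewrite !bilE; ring.
rewrite happZ.
apply: form_inj => t; rewrite !bilE; ring.
Qed.

(** The form is [so(V)]-invariant: the sign [tau] occurs twice on a product
    of two vectors. *)
Lemma spin_rep_skew (a : 'End(V)) s t : so a ->
  h (spin_rep rho a s) t = - h s (spin_rep rho a t).
Proof.
move=> soa; rewrite !spin_repE !bilE bil_suml bil_sumr -mulrN -sumrN.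
congr (_ * _); apply: eq_bigr => i _; rewrite !bilE !(form_tau hf).
rewrite (mulrA tau) (form_tau_sq hf) mul1r (clifford_polar (a _)).
have := soa (e i) (e i); rewrite (pseudo_euclideanC (e i)) => /eqP.
rewrite -mulr2n mulrn_eq0 /= => /eqP ->.
by rewrite mulr0 scale0r subr0 bilE mulrN.
Qed.

Lemma spin_rep_rotation i j s : i != j ->
  spin_rep rho (linfun (plane_rotation i j)) s
    = 2^-1 *: rho (e i) (rho (e j) s).
Proof.
move=> ij; have ji : j != i by rewrite eq_sym.
rewrite spin_repE (bigD1 i) // (bigD1 j) //= big1 ?addr0 => [|k /andP [ki kj]].
  rewrite !lfunE /= /plane_rotation !mxE !eqxx /= (negPf ij) (negPf ji) /=.
  rewrite !mulr1 !mulr0 !scale0r subr0 sub0r !happE opp_lfunE !scale_lfunE.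
  rewrite !happE (clifford_polar (e j)).
  apply: form_inj => t; rewrite !pseudo_euclidean_basis2 !eqxx (negPf ji).
  rewrite !bilE /=; move: (h _ t) => z.
  transitivity (4^-1 * (basis_norm R i * basis_norm R i * z
                        + basis_norm R j * basis_norm R j * z)); first by ring.
  by rewrite !basis_norm_sq; field.
rewrite !lfunE /= /plane_rotation !mxE !eqxx /= ![_ == k]eq_sym.
by rewrite (negPf ki) (negPf kj) !mulr0 !scale0r subr0 !linear0 zero_lfunE
  linear0 scaler0.
Qed.

End Algebra.

(** * Decomposition into admissible endomorphisms *)

Lemma sq1_sign (R : realType) (c : R) : c * c = 1 -> c = 1 \/ c = -1.
Proof.
by rewrite -expr2 => /eqP; rewrite sqrf_eq1 => /orP [] /eqP; [left|right].
Qed.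

Section Grading.
Variables (R : realType) (V S : vectType R) (rho : 'Hom(V, 'End(S))).

(** The endomorphism [E] equal to the identity on [Sp] and to minus the
    identity on [Sm]. *)
Lemma grading_operator (Sp Sm : {vspace S}) :
  semispinor_decomposition rho Sp Sm ->
  exists E : 'End(S), [/\ forall s, E (E s) = s, sign_commutes rho (-1) E,
    forall s, (s \in Sp) = (E s == s) & forall s, (s \in Sm) = (E s == - s)].
Proof.
case=> sumS cap0 [_ evp _] _ [oddp minm].
have rhop v s : s \in Sp -> rho v s \in Sm.
  move=> sp; have /subvP := oddp [:: v] isT; apply.
  by have := memv_img (clprod rho [:: v]) sp; rewrite /= comp_lfunE id_lfunE.
have rhom v s : s \in Sm -> rho v s \in Sp.
  rewrite memv_preim; apply/subvP/minm => vs ovs.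
  apply/subvP => x /memv_imgP [y yp ->]; rewrite -memv_preim.
  have ev : even_word (v :: vs) by rewrite /even_word /= negbK.
  have /subvP := evp _ ev; apply; rewrite -comp_lfunE; exact: memv_img.
pose a s := daddv_pi Sp Sm s; pose b s := daddv_pi Sm Sp s.
have ab s : a s + b s = s by apply: daddv_pi_add; rewrite // sumS memvf.
have ap s : a s \in Sp by apply: memv_pi.
have bm s : b s \in Sm by apply: memv_pi.
pose E : 'End(S) := daddv_pi Sp Sm - daddv_pi Sm Sp.
have Eab s : E s = a s - b s by rewrite add_lfunE opp_lfunE.
have Ep s : s \in Sp -> E s = s.
  move=> sp; have := ab s; rewrite Eab /a daddv_pi_id // => /eqP.
  by rewrite eq_sym addrC -subr_eq subrr eq_sym => /eqP ->; rewrite subr0.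
have Em s : s \in Sm -> E s = - s.
  move=> sm; have := ab s; rewrite Eab /b daddv_pi_id 1?capvC // => /eqP.
  by rewrite eq_sym -subr_eq subrr eq_sym => /eqP ->; rewrite sub0r.
have half (x : S) : x = - x -> x = 0.
  move/eqP; rewrite -addr_eq0 -mulr2n -scaler_nat scaler_eq0 pnatr_eq0 /=.
  by move/eqP.
exists E; split.
- by move=> s; rewrite (Eab s) happB Ep // Em // opprK ab.
- move=> v s; rewrite scaleN1r -{1}[s]ab happD happD Em ?rhop //.
  by rewrite Ep ?rhom // Eab happB opprB addrC.
- move=> s; apply/idP/eqP => [/Ep //|].
  rewrite Eab -{3}[s]ab => /addrI /esym /half b0; rewrite -[s]ab b0 addr0.
  exact: ap.
- move=> s; apply/idP/eqP => [/Em //|].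
  rewrite Eab -{3}[s]ab opprD => /addIr /half a0; rewrite -[s]ab a0 add0r.
  exact: bm.
Qed.

End Grading.

Lemma plane_rotationl (R : realType) p q (i j : 'I_(p + q)) : j != i ->
  plane_rotation i j (delta_mx 0 i) = basis_norm R i *: delta_mx 0 j.
Proof.
move=> ji; rewrite /plane_rotation !mxE !eqxx (negPf ji) /=.
by rewrite mulr1 mulr0 scale0r subr0.
Qed.

Lemma plane_rotationr (R : realType) p q (i j : 'I_(p + q)) : j != i ->
  plane_rotation i j (delta_mx 0 j) = - basis_norm R j *: delta_mx 0 i.
Proof.
move=> ji; rewrite /plane_rotation !mxE !eqxx eq_sym (negPf ji) /=.
by rewrite mulr1 mulr0 scale0r sub0r scaleNr.
Qed.

Section Spanning.
Variables (R : realType) (p q : nat).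
Local Notation V := 'rV[R]_(p + q).
Local Notation g := (@pseudo_euclidean R p q).
Local Notation e i := (delta_mx 0 i : V).
Variables (S : vectType R) (rho : 'Hom(V, 'End(S))).
Hypothesis hS : spinor_module g rho.
Variables (Sp Sm : {vspace S}).
Hypothesis hSpm : Cl0_reducible rho -> semispinor_decomposition rho Sp Sm.
Variables (h : bilform R S) (tau eps : R).
Hypothesis hf : clifford_form rho h tau eps.
Implicit Types (v w x : V) (s t : S) (A B Z : 'End(S)).

Let irr := hS.2.

Lemma spinor_exists : exists s : S, s != 0.
Proof. by exists (vpick fullv); rewrite vpick0 (spinors_neq0 irr). Qed.

Lemma j_rhoE A v s t : j_rho rho (h_form h A) v s t = h (A (rho v s)) t.
Proof. by rewrite /j_rho /h_form !comp_lfunE. Qed.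

Lemma sign_commutes_schur c A :
  c * c = 1 -> sign_commutes rho c A -> schur_algebra rho A.
Proof.
move=> cc cA a soa; apply/lfunP => s; rewrite !comp_lfunE !spin_repE.
rewrite happZ happ_sum; congr (_ *: _); apply: eq_bigr => i _.
by rewrite happZ; congr (_ *: _); rewrite !cA happZ scalerA cc scale1r.
Qed.

Lemma j_schur_equivariant A : schur_algebra rho A ->
  so_equivariant rho (j_rho rho (h_form h A)).
Proof.
move=> sA a soa v s t; rewrite !j_rhoE (spin_rep_commutator hS hf) //.
have /lfunP/(_ (rho v s)) := sA a soa; rewrite !comp_lfunE happB => ->.
by rewrite !bilE (spin_rep_skew hS hf) // addrC.
Qed.

Lemma j_injective c A : A != 0 -> c * c = 1 -> sign_commutes rho c A ->
  injective (j_rho rho (h_form h A)).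
Proof.
move=> A0 cc cA v w jvw; apply/eqP; rewrite -subr_eq0; set u := v - w.
have Au s : A (rho u s) = 0.
  apply: (form_nondeg hf) => t; move/lfunP/(_ s)/lfunP/(_ t): jvw.
  rewrite !j_rhoE happB !add_lfunE opp_lfunE happB !bilE => ->.
  exact: subrr.
have ru s : rho u s = 0.
  apply/eqP; apply: contraNT A0 => r0; apply/eqP.
  exact: (sign_commutes_eq0 irr cA r0).
have [s s0] := spinor_exists.
have gu x : g x u = 0.
  have := clifford_polar hS hf u x s; rewrite !ru happ0 oppr0 sub0r.
  move/esym/eqP; rewrite oppr_eq0 scaler_eq0 (negPf s0) orbF mulf_eq0.
  by rewrite pnatr_eq0 /= pseudo_euclideanC => /eqP.
rewrite -[u]pseudo_euclidean_expand big1 ?eqxx // => i _.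
by rewrite gu mulr0 scale0r.
Qed.

(** Every bilinear form on [S] is [h B] for an endomorphism [B]. *)
Lemma form_operator (k : bilform R S) :
  exists B : 'End(S), forall s t, h (B s) t = k s t.
Proof.
exists (h^-1 \o k)%VF => s t; rewrite comp_lfunE limg_lfunVK //.
suff -> : limg h = fullv by apply: memvf.
have k0 : lker h = 0%VS.
  apply/eqP; rewrite -subv0; apply/subvP => x.
  rewrite memv_ker memv0 => /eqP hx; apply/eqP/(form_nondeg hf) => t'.
  by rewrite hx zero_lfunE.
apply/eqP; rewrite eqEdim subvf limg_dim_eq ?k0 ?capv0 //.
by rewrite !dimvf /dim /= muln1.
Qed.

(** The adjoint with respect to [h], on either side since [h] is symmetric or
    skew. *)
Lemma adjoint A : exists B, (forall s t, h (B s) t = h s (A t)) /\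
  forall s t, h (A s) t = h s (B t).
Proof.
have [k hk] : exists k : bilform R S, forall s, k s = (h s \o A)%VF.
  apply: linear_hom => a x y; apply/lfunP => t.
  by rewrite add_lfunE scale_lfunE !comp_lfunE bilDl bilZl.
have [B hB] := form_operator k.
have hB' s t : h (B s) t = h s (A t) by rewrite hB hk comp_lfunE.
exists B; split=> // s t.
by rewrite (form_sym hf) -hB' (form_sym hf) mulrA (form_eps_sq hf) mul1r.
Qed.

Lemma adjoint_sign_commutes c A B : c * c = 1 -> sign_commutes rho c A ->
  (forall s t, h (B s) t = h s (A t)) -> sign_commutes rho c B.
Proof.
move=> cc cA hB v s; apply: (form_inj hf) => t.
rewrite hB (form_tau hf) bilZl (form_tau hf) hB mulrCA; congr (_ * _).
by rewrite cA bilZr mulrA cc mul1r.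
Qed.

(** The grading is selfadjoint or skew: [E E^*] is a selfadjoint element of
    the commutant of the Clifford algebra, hence a scalar. *)
Lemma grading_adjoint (E : 'End(S)) :
  (forall s, E (E s) = s) -> sign_commutes rho (-1) E ->
  exists d, d * d = 1 /\ forall s t, h (E s) t = d * h s (E t).
Proof.
move=> EE cE; have [E' [hE' hE]] := adjoint E.
have cE' : sign_commutes rho (-1) E'.
  by apply: adjoint_sign_commutes cE hE'; rewrite mulrNN mulr1.
have [|s t|a ha] := @form_scalar _ _ _ _ _ _ _ hf (E \o E')%VF.
- by move=> v s; rewrite !comp_lfunE cE' happZ cE scalerA mulrNN mulr1.
- by rewrite !comp_lfunE hE hE'.
have E'E s : E' s = a *: E s.
  by rewrite -[E' s]EE; move: (ha s); rewrite comp_lfunE => ->; rewrite happZ.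
have E'E' s : E' (E' s) = s.
  by apply: (form_inj hf) => t; rewrite !hE' EE.
have aa : a * a = 1.
  have [s s0] := spinor_exists; have := E'E' s.
  rewrite !E'E happZ EE scalerA => /eqP; rewrite -subr_eq0 -[X in _ - X]scale1r.
  by rewrite -scalerBl scaler_eq0 (negPf s0) orbF subr_eq0 => /eqP.
exists a; split=> // s t.
by rewrite -hE' E'E bilZl mulrA aa mul1r.
Qed.

(** [A] is a sum of admissible elements of the Schur algebra. *)
Definition admissible_sum A := exists l : seq 'End(S),
  (forall B, B \in l -> schur_algebra rho B /\ admissible rho h Sp Sm B) /\
  A = \sum_(B <- l) B.

Lemma admissible_sumD A B :
  admissible_sum A -> admissible_sum B -> admissible_sum (A + B).
Proof.
move=> [l [hl ->]] [l' [hl' ->]]; exists (l ++ l'); split;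
  last by rewrite big_cat.
by move=> C; rewrite mem_cat => /orP [/hl|/hl'].
Qed.

Lemma admissible_sum1 A c b : c * c = 1 -> b * b = 1 ->
  sign_commutes rho c A -> (forall s t, h (A s) t = b * h s (A t)) ->
  (Cl0_reducible rho ->
    ((A @: Sp <= Sp)%VS /\ (A @: Sm <= Sm)%VS) \/
    ((A @: Sp <= Sm)%VS /\ (A @: Sm <= Sp)%VS)) ->
  admissible_sum A.
Proof.
move=> cc bb cA hA hSA; have [->|A0] := eqVneq A 0.
  by exists [::]; split=> //; rewrite big_nil.
exists [:: A]; split; last by rewrite big_seq1.
move=> B; rewrite inE => /eqP ->; split; first exact: (sign_commutes_schur cc).
split=> //.
- case: (sq1_sign cc) => ce; [left|right] => v; apply/lfunP => s.
    by rewrite !comp_lfunE cA ce scale1r.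
  by rewrite opp_lfunE !comp_lfunE cA ce scaleN1r.
- case: (sq1_sign bb) => be; [left|right] => s t; rewrite hA be.
    by rewrite mul1r.
  by rewrite mulN1r.
Qed.

Lemma halves A B : A = 2^-1 *: (A + B) + 2^-1 *: (A - B).
Proof.
rewrite -scalerDr addrACA subrr addr0 -mulr2n -scaler_nat scalerA mulVf.
  by rewrite scale1r.
by rewrite pnatr_eq0.
Qed.

(** If [S] is reducible, conjugation by the grading [E] splits [A] into a part
    that preserves [Sp] and [Sm] and a part that exchanges them. *)
Lemma admissible_sum_selfadjoint A c b : c * c = 1 -> b * b = 1 ->
  sign_commutes rho c A -> (forall s t, h (A s) t = b * h s (A t)) ->
  admissible_sum A.
Proof.
move=> cc bb cA hA; have [red|/contrapT nred] := pselect (Cl0_reducible rho);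
  last by apply: (@admissible_sum1 A c b).
have [E [EE cE Ep Em]] := grading_operator (hSpm red).
have [d [dd hE]] := grading_adjoint EE cE.
rewrite (halves A (E \o A \o E)%VF).
have cEAE : sign_commutes rho c (E \o A \o E)%VF.
  move=> v s; rewrite !comp_lfunE cE !happZ cA !happZ cE.
  by rewrite !scalerA mulN1r mulrN1 opprK.
have hEAE s t : h ((E \o A \o E)%VF s) t = b * h s ((E \o A \o E)%VF t).
  by rewrite !comp_lfunE hE hA hE !mulrA [d * b]mulrC -(mulrA b) dd mulr1.
(* The part of [A] on which conjugation by [E] is the sign [k]. *)
have part k : k * k = 1 -> admissible_sum (2^-1 *: (A + k *: (E \o A \o E)%VF)).
  move=> kk; set B := 2^-1 *: _.
  have BE s : E (B s) = k *: B (E s).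
    rewrite /B !scale_lfunE !add_lfunE !scale_lfunE !comp_lfunE !happE !EE.
    rewrite !scalerDr !scalerA mulrCA kk mulr1 addrC.
    by congr (_ *: _ + _); ring.
  apply: (@admissible_sum1 B c b) => //.
  - move=> v s; rewrite /B !scale_lfunE !add_lfunE !scale_lfunE cEAE cA !happE.
    by rewrite !scalerDr !scalerA; congr (_ *: _ + _ *: _); ring.
  - move=> s t; rewrite /B !scale_lfunE !add_lfunE !scale_lfunE !bilE hA hEAE.
    by ring.
  - move=> _; case: (sq1_sign kk) => ke; [left|right]; rewrite ke in BE;
      split; apply/subvP => x /memv_imgP [s]; rewrite ?Ep ?Em => /eqP es ->;
      rewrite ?Ep ?Em BE es ?happN ?scale1r ?scaleN1r ?opprK //.
apply: admissible_sumD.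
  by rewrite -[X in A + X]scale1r; apply: part; ring.
by rewrite -[X in A + X]scaleN1r; apply: part; ring.
Qed.

(** The symmetric and the skew part of [A]. *)
Lemma admissible_sum_commutes A c : c * c = 1 -> sign_commutes rho c A ->
  admissible_sum A.
Proof.
move=> cc cA; have [B [hB hA]] := adjoint A.
have cB := adjoint_sign_commutes cc cA hB.
have part k : k * k = 1 -> admissible_sum (2^-1 *: (A + k *: B)).
  move=> kk; apply: (@admissible_sum_selfadjoint _ c k) => //.
    move=> v s; rewrite !scale_lfunE !add_lfunE !scale_lfunE cA cB !happE.
    by rewrite !scalerDr !scalerA; congr (_ *: _ + _ *: _); ring.
  move=> s t; rewrite !scale_lfunE !add_lfunE !scale_lfunE !bilE hA hB.
  move: (h s (B t)) (h s (A t)) => x y.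
  by transitivity (2^-1 * (k * k * x + k * y)); [rewrite kk|]; ring.
rewrite (halves A B); apply: admissible_sumD.
  by rewrite -[X in A + X]scale1r; apply: part; ring.
by rewrite -[X in A + X]scaleN1r; apply: part; ring.
Qed.

Lemma sign_commutes_basis c A :
  (forall i s, A (rho (e i) s) = c *: rho (e i) (A s)) -> sign_commutes rho c A.
Proof.
move=> cA v s; rewrite [v]row_sum_delta !happ_sum !sum_lfunE happ_sum.
rewrite scaler_sumr; apply: eq_bigr => i _.
by rewrite !happZ !scale_lfunE happZ cA !scalerA mulrC.
Qed.

Lemma clifford_basis_sq i s :
  rho (e i) (rho (e i) s) = - basis_norm R i *: s.
Proof.
by rewrite clifford_sq // pseudo_euclidean_basis2 eqxx mulr1.
Qed.

(** An element of the commutant of the even Clifford algebra splits under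
    conjugation by a basis vector into a part commuting and a part
    anticommuting with the Clifford multiplications. *)
Lemma admissible_sum_even i0 A :
  (forall j s, A (rho (e i0) (rho (e j) s)) = rho (e i0) (rho (e j) (A s))) ->
  admissible_sum A.
Proof.
move=> evA; set n0 := basis_norm R i0.
have nn : n0 * n0 = 1 by apply: basis_norm_sq.
pose B : 'End(S) := - n0 *: (rho (e i0) \o A \o rho (e i0))%VF.
have BE s : B s = - n0 *: rho (e i0) (A (rho (e i0) s)).
  by rewrite scale_lfunE !comp_lfunE.
clearbody B.
have Be j s : B (rho (e j) s) = rho (e j) (A s).
  rewrite BE evA clifford_basis_sq scalerA mulrNN nn scale1r //.
have Ae j s : A (rho (e j) s) = rho (e j) (B s).
  rewrite BE happZ; have [->|ji] := eqVneq j i0.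
    by rewrite clifford_basis_sq scalerA mulrNN nn scale1r.
  have anti (x : S) : rho (e j) (rho (e i0) x) = - rho (e i0) (rho (e j) x).
    rewrite (clifford_polar hS hf) pseudo_euclidean_basis2 (negPf ji) !mulr0.
    by rewrite scale0r subr0.
  rewrite anti -evA anti !happN opprK clifford_basis_sq happZ scalerA.
  by rewrite mulrNN nn scale1r.
have part k : k * k = 1 -> admissible_sum (2^-1 *: (A + k *: B)).
  move=> kk; apply: (@admissible_sum_commutes _ k) => //.
  apply: sign_commutes_basis => j s.
  rewrite !scale_lfunE !add_lfunE !scale_lfunE Ae Be !happE.
  rewrite !scalerDr !scalerA (mulrCA k) kk mulr1 addrC.
  by congr (_ *: _ + _); ring.
rewrite (halves A B); apply: admissible_sumD.
  by rewrite -[X in A + X]scale1r; apply: part; ring.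
by rewrite -[X in A + X]scaleN1r; apply: part; ring.
Qed.

(** An equivariant [b] from [V] to [End S] is the composition of the Clifford
    multiplication with an element of the commutant of the even Clifford
    algebra. With [w] the product of [e i0] and [e j], the infinitesimal
    rotation in their plane, applied twice to [e i0], gives that [b (e i0)]
    anticommutes with [w]; applied once, it recovers [b (e j)] from
    [b (e i0)]. *)
Lemma equivariant_operator (i0 : 'I_(p + q)) (b : V -> 'End(S)) :
  (forall a v s, so a ->
    b (a v) s = spin_rep rho a (b v s) - b v (spin_rep rho a s)) ->
  (forall v s, b v s = \sum_i v 0 i *: b (e i) s) ->
  exists A, (forall v s, b v s = A (rho v s)) /\
    forall j s, A (rho (e i0) (rho (e j) s)) = rho (e i0) (rho (e j) (A s)).
Proof.
move=> eqb linb; set n0 := basis_norm R i0.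
have nn : n0 * n0 = 1 by apply: basis_norm_sq.
have bZ a v s : b (a *: v) s = a *: b v s.
  rewrite linb [in RHS]linb scaler_sumr; apply: eq_bigr => i _.
  by rewrite mxE scalerA.
pose w j : 'End(S) := (rho (e i0) \o rho (e j))%VF.
have wE j s : w j s = rho (e i0) (rho (e j) s) by rewrite comp_lfunE.
have anti j (x : S) : j != i0 -> rho (e j) (rho (e i0) x) = - w j x.
  move=> ji; rewrite (clifford_polar hS hf) pseudo_euclidean_basis2 (negPf ji).
  by rewrite !mulr0 scale0r subr0 wE.
have ww j s : j != i0 -> w j (w j s) = (- (n0 * basis_norm R j)) *: s.
  move=> ji; rewrite !wE anti // wE happN !clifford_basis_sq.
  by rewrite !scalerA -scaleNr mulrNN.
(* The rotation maps [e i0] to [n0 *: e j] and acts on spinors as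
   [2^-1 *: w j]. *)
have rot1 j s : j != i0 ->
    n0 *: b (e j) s = 2^-1 *: (w j (b (e i0) s) - b (e i0) (w j s)).
  move=> ji; have := eqb _ (e i0) s (@plane_rotation_so R p q i0 j).
  rewrite !(spin_rep_rotation hS hf) 1?eq_sym // lfunE /= plane_rotationl //.
  by rewrite bZ -!wE happZ -scalerBr.
have rot2 j s : j != i0 ->
    - basis_norm R j *: b (e i0) s =
      2^-1 *: (w j (b (e j) s) - b (e j) (w j s)).
  move=> ji; have := eqb _ (e j) s (@plane_rotation_so R p q i0 j).
  rewrite !(spin_rep_rotation hS hf) 1?eq_sym // lfunE /= plane_rotationr //.
  by rewrite bZ -!wE happZ -scalerBr.
have bjE j s : j != i0 ->
    b (e j) s = (n0 / 2) *: (w j (b (e i0) s) - b (e i0) (w j s)).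
  by move=> ji; rewrite -scalerA -rot1 // scalerA nn scale1r.
have wbw j s : j != i0 ->
    w j (b (e i0) (w j s)) = (n0 * basis_norm R j) *: b (e i0) s.
  move=> ji; apply: (form_inj hf) => t; move: (rot2 j s ji).
  rewrite !(bjE j) // happZ !happB ww // ww // happZ.
  move=> /(congr1 (fun x : S => h x t)).
  rewrite !bilE; move: (h (w j _) t) (h (b _ s) t) (basis_norm R j) => z y n.
  have e1 : n0 * n0 * (n * y) = n * y by rewrite nn mul1r.
  have e2 : n0 * n0 * z = z by rewrite nn mul1r.
  by move=> eyz; rewrite -e2 -!mulrA; congr (_ * _); lra.
have wb j s : j != i0 -> w j (b (e i0) s) = - b (e i0) (w j s).
  move=> ji; have := wbw j (w j s) ji; rewrite ww // happZ happZ => /eqP.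
  rewrite -subr_eq0 scaleNr -opprD -scalerDr oppr_eq0 scaler_eq0 addr_eq0.
  rewrite mulf_eq0 => /orP [/orP []|/eqP //] /eqP z0.
    by move: nn; rewrite z0 mul0r => /eqP; rewrite eq_sym oner_eq0.
  have := basis_norm_sq R j; rewrite z0 mul0r => /eqP.
  by rewrite eq_sym oner_eq0.
pose A : 'End(S) := - n0 *: (b (e i0) \o rho (e i0))%VF.
have AE s : A s = - n0 *: b (e i0) (rho (e i0) s).
  by rewrite scale_lfunE comp_lfunE.
clearbody A; exists A; split.
  suff bA j s : b (e j) s = A (rho (e j) s).
    move=> v s; rewrite linb [in RHS](row_sum_delta v) !happ_sum sum_lfunE.
    rewrite happ_sum; apply: eq_bigr => i _.
    by rewrite bA !happZ scale_lfunE happZ.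
  rewrite AE; have [->|ji] := eqVneq j i0.
    by rewrite clifford_basis_sq happZ scalerA mulrNN nn scale1r.
  rewrite -wE (bjE j) // wb // -opprD scalerN -mulr2n.
  by rewrite -scaler_nat scalerA divfK ?pnatr_eq0 // scaleNr.
move=> j s; have [->|ji] := eqVneq j i0.
  by rewrite !clifford_basis_sq !happZ.
rewrite -!wE !AE happZ wb //; congr (_ *: _).
by rewrite [in RHS]wE anti // happN happN opprK wE.
Qed.

End Spanning.

(** * Equivariant maps as combinations of embeddings *)

Section SpanningTheorem.
Variables (R : realType) (p q : nat).
Local Notation V := 'rV[R]_(p + q).
Local Notation g := (@pseudo_euclidean R p q).
Local Notation e i := (delta_mx 0 i : V).
Variables (S : vectType R) (rho : 'Hom(V, 'End(S))).
Hypothesis hS : spinor_module g rho.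
Variables (Sp Sm : {vspace S}).
Hypothesis hSpm : Cl0_reducible rho -> semispinor_decomposition rho Sp Sm.
Variables (h : bilform R S) (tau eps : R).
Hypothesis hf : clifford_form rho h tau eps.

Lemma admissible_embedding A : schur_algebra rho A ->
  admissible rho h Sp Sm A ->
  so_equivariant rho (j_rho rho (h_form h A)) /\
  injective (j_rho rho (h_form h A)).
Proof.
move=> sA [A0 cA _ _]; split; first exact: (j_schur_equivariant hS hf).
case: cA => cA.
  apply: (j_injective hS hf (c := 1)) => //; first by rewrite mulr1.
  by move=> v s; have /lfunP/(_ s) := cA v; rewrite !comp_lfunE scale1r.
apply: (j_injective hS hf (c := -1)) => //; first by rewrite mulrNN mulr1.
move=> v s; have /lfunP/(_ s) := cA v.
by rewrite opp_lfunE !comp_lfunE scaleN1r.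
Qed.

Lemma equivariant_admissible_sum (i0 : 'I_(p + q)) (j : 'Hom(V, bilform R S)) :
  so_equivariant rho j ->
  exists2 A, admissible_sum rho Sp Sm h A &
    forall v s t, j v s t = h (A (rho v s)) t.
Proof.
move=> eqj.
have /choice [b hb] :
    forall v, exists B : 'End(S), forall s t, h (B s) t = j v s t.
  by move=> v; apply: (form_operator hf).
have [||A [bA evA]] := @equivariant_operator _ _ _ _ _ hS _ _ _ hf i0 b.
- move=> a v s soa; apply: (form_inj hf) => t.
  rewrite hb (eqj _ soa) !bilE (spin_rep_skew hS hf) // !hb.
  by rewrite [RHS]addrC.
- move=> v s; apply: (form_inj hf) => t.
  rewrite hb bil_suml [in LHS](row_sum_delta v) happ_sum !sum_lfunE.
  by apply: eq_bigr => i _; rewrite happZ !scale_lfunE bilZl hb.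
exists A; first exact: (admissible_sum_even hS hSpm hf evA).
by move=> v s t; rewrite -bA hb.
Qed.

Lemma equivariant_combination (j : 'Hom(V, bilform R S)) : (0 < p + q)%N ->
  so_equivariant rho j ->
  exists (N : nat) (c : 'I_N -> R) (A : 'I_N -> 'End(S)),
    (forall k, schur_algebra rho (A k) /\ admissible rho h Sp Sm (A k)) /\
    forall v, j v = \sum_(k < N) c k *: j_rho rho (h_form h (A k)) v.
Proof.
move=> n0 eqj.
have [_ [l [hl ->]] jA] := equivariant_admissible_sum (Ordinal n0) eqj.
exists (size l), (fun=> 1), (fun k => l`_k); split.
  by move=> k; apply/hl/mem_nth.
move=> v; apply/lfunP => s; apply/lfunP => t.
rewrite jA (big_nth 0) big_mkord !sum_lfunE bil_suml.
by apply: eq_bigr => k _; rewrite scale1r j_rhoE.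
Qed.

End SpanningTheorem.

(** * Inversion numbers *)

Section Inversions.
Variable m : nat.
Implicit Types (I K L : {set 'I_m}) (i : 'I_m).

(** The number of elements of [K] below [i]. *)
Definition below K i : nat := \sum_(b in K) (b < i)%N.

Lemma card_below K i : #|[set k in K | (k < i)%N]| = below K i.
Proof.
rewrite -sum1_card [in RHS]/below big_mkcond [in RHS]big_mkcond /=.
by apply: eq_bigr => k _; rewrite inE; case: (k \in K); case: (k < i)%N.
Qed.

Lemma ninvE I K : ninv I K = \sum_(a in I) below K a.
Proof.
rewrite /ninv /below pair_big /= -sum1_card big_mkcond [in RHS]big_mkcond /=.
apply: eq_bigr => -[a b] _; rewrite inE /=.
by case: (a \in I); case: (b \in K); case: (b < a)%N.
Qed.

Lemma below_setU1 L i j : i \notin L ->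
  below (i |: L) j = ((i < j)%N + below L j)%N.
Proof. by move=> iL; rewrite /below big_setU1. Qed.

Lemma below_setU1_self L i : below (i |: L) i = below L i.
Proof.
have [iL|iL] := boolP (i \in L); first by rewrite setUC (setUidPl _) // sub1set.
by rewrite below_setU1 // ltnn.
Qed.

Lemma setCU1 L i : ~: (i |: L) = (~: L) :\ i.
Proof. by apply/setP => k; rewrite !inE negb_or. Qed.

Lemma setU1C L i : i \notin L -> i |: ~: (i |: L) = ~: L.
Proof. by move=> iL; rewrite setCU1 setD1K // inE. Qed.

Lemma below_setC1_self L i : below (~: (i |: L)) i = below (~: L) i.
Proof.
have [iL|iL] := boolP (i \in L); first by rewrite setUC (setUidPl _) // sub1set.
by rewrite -[in RHS](setU1C iL) below_setU1_self.
Qed.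

(** Moving [i] from the complement of [L] into [L] changes the number of
    inversions between [L] and its complement by the number of elements of the
    complement below [i] minus the number of elements of [L] above [i]. *)
Lemma ninv_setU1 L i : i \notin L ->
  (ninv (i |: L) (~: (i |: L)) + #|L| =
   ninv L (~: L) + below (~: L) i + below L i)%N.
Proof.
move=> iL; rewrite !ninvE big_setU1 //= below_setC1_self.
have -> : (\sum_(a in L) below (~: L) a =
    \sum_(a in L) below (~: (i |: L)) a + \sum_(a in L) (i < a)%N)%N.
  rewrite -big_split; apply: eq_bigr => a _ /=.
  by rewrite -[in LHS](setU1C iL) below_setU1 ?inE ?eqxx // addnC.
have -> : #|L| = (\sum_(a in L) (i < a)%N + below L i)%N.
  rewrite /below -big_split -sum1_card; apply: eq_bigr => a aL /=.
  have : a != i by apply: contraNneq iL => <-.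
  by rewrite neq_ltn; case: ltngtP.
move: (\sum_(a in L) below _ a)%N (\sum_(a in L) _)%N => x y.
by move: (below _ _) (below _ _) => *; lia.
Qed.

Lemma ninv_setC I : (ninv I (~: I) + ninv (~: I) I = #|I| * #|~: I|)%N.
Proof.
rewrite !ninvE /below [X in (_ + X)%N]exchange_big -big_split /=.
rewrite -sum_nat_const; apply: eq_bigr => a aI.
rewrite -sum1_card -big_split; apply: eq_bigr => b /=; rewrite inE => bI.
have : a != b by apply: contraNneq bI => <-.
by rewrite neq_ltn; case: ltngtP.
Qed.

Lemma triangularS n : (n.+1 * n.+2)./2 = ((n * n.+1)./2 + n.+1)%N.
Proof.
have -> : (n.+1 * n.+2 = n * n.+1 + n.+1.*2)%N by lia.
by rewrite halfD odd_double andbF doubleK.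
Qed.

Lemma triangularD n k :
  ((n + k) * (n + k).+1)./2 = ((n * n.+1)./2 + (k * k.+1)./2 + n * k)%N.
Proof.
elim: k => [|k IH]; first by rewrite !addn0 muln0 addn0.
by rewrite addnS triangularS IH triangularS; lia.
Qed.

End Inversions.

(** * The forms f and f_E on the split spinor module *)

Section SplitSpinorForms.
Variables (R : realType) (m : nat).
Implicit Types (s t vol : extalg R m) (I K L : {set 'I_m}) (i : 'I_m).

Lemma sign_sq n : (-1) ^+ n * (-1) ^+ n = 1 :> R.
Proof. by rewrite -exprMn mulrNN mulr1 expr1n. Qed.

(** The basis vector [e_I] of the exterior algebra. *)
Definition ext_basis I : extalg R m := [ffun K : {set 'I_m} => (K == I)%:R].

(** The value of [f] on [e_I] and the complementary basis vector, for
    [vol = e_1 /\ ... /\ e_m]. *)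
Definition pairing_sign I : R :=
  (-1) ^+ ((#|I| * #|I|.+1)./2 + ninv I (~: I)).

Lemma card_setC_ord I : #|~: I| = (m - #|I|)%N.
Proof. by have := cardsC I; rewrite card_ord; lia. Qed.

Lemma split_f_sum vol s t :
  split_f vol s t =
    (\sum_I pairing_sign I * s I * t (~: I)) / vol [set: 'I_m].
Proof.
rewrite /split_f.
rewrite (eq_bigr (fun i : 'I_m.+1 => \sum_I (-1) ^+ (i * i.+1)./2 *
   ((-1) ^+ ninv I (~: I) * component i s I * component (m - i) t (~: I))
   / vol [set: 'I_m])); last first.
  move=> i _; rewrite ffunE !mulr_suml mulr_sumr.
  apply: eq_big => [I|I _]; first exact: subsetT.
  by rewrite setTD !mulrA.
rewrite exchange_big mulr_suml; apply: eq_bigr => I _ /=.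
have Im : (#|I| < m.+1)%N by have := max_card (mem I); rewrite card_ord.
rewrite (bigD1 (Ordinal Im)) //= big1 ?addr0 => [|k kI].
  by rewrite !ffunE eqxx card_setC_ord eqxx /pairing_sign exprD !mulrA.
rewrite !ffunE; case: eqP => [e|_]; last by rewrite !(mulr0, mul0r).
by case/negP: kI; apply/eqP/val_inj.
Qed.

(** The sign rule behind the antisymmetry of [f] for Clifford
    multiplication. *)
Lemma pairing_sign_setU1 i L : i \notin L ->
  pairing_sign (i |: L) * (-1) ^+ below L i =
    - (pairing_sign L * (-1) ^+ below (~: L) i).
Proof.
move=> iL; rewrite /pairing_sign -!exprD -[RHS]mulN1r -exprS.
have := ninv_setU1 iL; rewrite cardsU1 iL triangularS.
move: (ninv _ _) (ninv _ _) (below _ _) (below _ _) => a b c d e.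
have <- : (((#|L| * #|L|.+1)./2 + a + d).+1 + c.*2 =
    (#|L| * #|L|.+1)./2 + #|L|.+1 + b + c)%N by move: (_./2) e => *; lia.
by rewrite exprD -mul2n exprM sqrrN expr1n expr1n mulr1.
Qed.

(** The sign rule behind the symmetry of [f]. *)
Lemma pairing_signC I :
  pairing_sign (~: I) = (-1) ^+ (m * m.+1)./2 * pairing_sign I.
Proof.
have -> : (m * m.+1)./2 = ((#|I| * #|I|.+1)./2 + (#|~: I| * #|~: I|.+1)./2
    + (ninv I (~: I) + ninv (~: I) I))%N.
  by have := cardsC I; rewrite card_ord ninv_setC -triangularD => ->.
rewrite /pairing_sign setCK !exprD.
move: (sign_sq (#|I| * #|I|.+1)./2) (sign_sq (ninv I (~: I))).
set a := (-1) ^+ (#|I| * _)./2; set d := (-1) ^+ ninv I _ => aa dd.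
rewrite -[LHS]mul1r -[X in X * _]mul1r -{1}aa -dd; ring.
Qed.

Lemma split_f_sym vol s t :
  split_f vol t s = (-1) ^+ (m * m.+1)./2 * split_f vol s t.
Proof.
rewrite !split_f_sum mulrA; congr (_ / _).
rewrite (reindex_inj (inv_inj (@setCK _))) mulr_sumr /=.
by apply: eq_bigr => I _; rewrite setCK pairing_signC; ring.
Qed.

Lemma split_fE_sym vol s t :
  split_fE vol t s = (-1) ^+ (m * m.+1)./2 * (-1) ^+ m * split_fE vol s t.
Proof.
rewrite /split_fE split_f_sym -!mulrA; congr (_ * _).
rewrite !split_f_sum mulrA; congr (_ / _).
rewrite mulr_sumr; apply: eq_bigr => I _; rewrite !ffunE.
have -> : (-1) ^+ m = (-1) ^+ #|I| * (-1) ^+ #|~: I| :> R.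
  by rewrite -exprD cardsC card_ord.
rewrite [in RHS]mulrA.
have := sign_sq #|I|; move: ((-1) ^+ _) ((-1) ^+ _) => a b aa.
rewrite -[LHS]mul1r -aa; ring.
Qed.

(** Clifford multiplication by [x + y] in coordinates. *)
Lemma split_cliffordE (x y : 'rV[R]_m) s K : split_clifford (x, y) s K =
  \sum_(i in K) (-1) ^+ below K i * x 0 i * s (K :\ i)
  - 2 * \sum_(i | i \notin K) (-1) ^+ below K i * y 0 i * s (i |: K).
Proof.
rewrite !ffunE; congr (_ - _ * _); last first.
  by apply: eq_bigr => i iK; rewrite card_below.
rewrite (eq_bigr (fun I : {set 'I_m} => \sum_i (I == [set i])%:R *
  ((-1) ^+ ninv I (K :\: I) * x 0 i * s (K :\: I)))); last first.
  move=> I _; rewrite ffunE mulr_sumr mulr_suml; apply: eq_bigr => i _; ring.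
rewrite exchange_big /= [RHS]big_mkcond; apply: eq_bigr => i _ /=.
rewrite -sub1set; have [iK|iK] := boolP ([set i] \subset K); last first.
  rewrite big1 // => I IK; case: eqP => [eI|_]; last by rewrite mul0r.
  by rewrite -eI IK in iK.
rewrite (bigD1 [set i]) //= eqxx mul1r big1 ?addr0 => [|I /andP [_ /negPf ->]];
  last by rewrite mul0r.
rewrite sub1set in iK.
by rewrite ninvE big_set1 -(below_setU1_self (K :\ i)) setD1K.
Qed.

Lemma reindex_setU1 i (F : {set 'I_m} -> R) :
  \sum_(K : {set 'I_m} | i \in K) F K =
  \sum_(L : {set 'I_m} | i \notin L) F (i |: L).
Proof.
rewrite (reindex_onto (fun L => i |: L) (fun K => K :\ i)) /=; last first.
  by move=> K iK; rewrite setD1K.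
apply: eq_bigl => L; rewrite !inE eqxx /=.
by apply/eqP/idP => [<-|iL]; [rewrite !inE eqxx|rewrite setU1K].
Qed.

(** The form [f] has the sign [-1]. *)
Lemma split_f_clifford vol xy s t :
  split_f vol (split_clifford xy s) t = - split_f vol s (split_clifford xy t).
Proof.
case: xy => x y; rewrite !split_f_sum -mulNr; congr (_ / _).
pose sg n : R := (-1) ^+ n.
have -> : \sum_I pairing_sign I * split_clifford (x, y) s I * t (~: I) =
  \sum_i x 0 i * (\sum_(L : {set 'I_m} | i \notin L)
     pairing_sign (i |: L) * sg (below L i) * (s L * t (~: (i |: L))))
  - 2 * \sum_i y 0 i * (\sum_(L : {set 'I_m} | i \notin L)
     pairing_sign L * sg (below L i) * (s (i |: L) * t (~: L))).
  pose F I i := x 0 i *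
    (pairing_sign I * sg (below I i) * (s (I :\ i) * t (~: I))).
  pose G I i := y 0 i *
    (pairing_sign I * sg (below I i) * (s (i |: I) * t (~: I))).
  transitivity (\sum_(I : {set 'I_m}) \sum_(i in I) F I i
                - 2 * \sum_(I : {set 'I_m}) \sum_(i | i \notin I) G I i).
    rewrite mulr_sumr -sumrB; apply: eq_bigr => I _.
    rewrite split_cliffordE mulrBr mulrBl !mulr_sumr !mulr_suml.
    by congr (_ - _); apply: eq_bigr => i _; rewrite /F /G /sg; ring.
  congr (_ - 2 * _); rewrite (exchange_big_dep predT) //=;
    apply: eq_bigr => i _; rewrite mulr_sumr // reindex_setU1.
  by apply: eq_bigr => L iL; rewrite /F setU1K // below_setU1_self.
have -> : \sum_I pairing_sign I * s I * split_clifford (x, y) t (~: I) =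
  \sum_i x 0 i * (\sum_(L : {set 'I_m} | i \notin L)
     pairing_sign L * sg (below (~: L) i) * (s L * t (~: (i |: L))))
  - 2 * \sum_i y 0 i * (\sum_(L : {set 'I_m} | i \notin L)
     pairing_sign (i |: L) * sg (below (~: L) i) * (s (i |: L) * t (~: L))).
  pose F I i := x 0 i *
    (pairing_sign I * sg (below (~: I) i) * (s I * t (~: I :\ i))).
  pose G I i := y 0 i *
    (pairing_sign I * sg (below (~: I) i) * (s I * t (i |: ~: I))).
  transitivity (\sum_(I : {set 'I_m}) \sum_(i | i \notin I) F I i
                - 2 * \sum_(I : {set 'I_m}) \sum_(i in I) G I i).
    rewrite mulr_sumr -sumrB; apply: eq_bigr => I _.
    rewrite split_cliffordE mulrBr !mulr_sumr.
    congr (_ - _); apply: eq_big => i; rewrite ?inE ?negbK //;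
      by move=> _; rewrite /F /G /sg; ring.
  congr (_ - 2 * _); rewrite (exchange_big_dep predT) //=;
    apply: eq_bigr => i _; rewrite mulr_sumr //.
    by apply: eq_bigr => L iL; rewrite /F setCU1.
  rewrite reindex_setU1; apply: eq_bigr => L iL.
  by rewrite /G below_setC1_self setU1C.
rewrite opprB addrC -mulrN -sumrN -[X in _ = _ + X]sumrN; congr (_ + _).
  congr (_ * _); apply: eq_bigr => i _; rewrite -mulrN -sumrN; congr (_ * _).
  apply: eq_bigr => L iL; rewrite -mulNr; congr (_ * _).
  have := pairing_sign_setU1 iL.
  have := sign_sq (below L i); have := sign_sq (below (~: L) i).
  rewrite /sg; move: (_ ^+ _) (_ ^+ _) (pairing_sign _) (pairing_sign _).
  move=> a b c d aa bb e.
  transitivity (d * a * (a * b)); last by rewrite -[RHS]mulr1 -bb; ring.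
  by rewrite e -[c * a]mulr1 -aa; ring.
apply: eq_bigr => i _; rewrite -mulrN -sumrN; congr (_ * _).
by apply: eq_bigr => L iL; rewrite pairing_sign_setU1 // mulNr.
Qed.

Lemma grading_clifford xy s :
  grading (split_clifford xy s) = - split_clifford xy (grading s).
Proof.
case: xy => x y; apply/ffunP => K; rewrite [LHS]ffunE [RHS]ffunE.
rewrite !split_cliffordE opprB mulrBr addrC mulrCA -mulrN.
congr (2 * _ + _).
  rewrite -mulrN -sumrN mulr_sumr; apply: eq_bigr => i iK.
  by rewrite [grading s _]ffunE cardsU1 iK exprS; ring.
rewrite mulr_sumr -sumrN; apply: eq_bigr => i iK.
by rewrite [grading s _]ffunE (cardsD1 i K) iK exprS; ring.
Qed.

Lemma split_fNl vol s t : split_f vol (- s) t = - split_f vol s t.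
Proof.
rewrite !split_f_sum -mulNr -sumrN; congr (_ / _); apply: eq_bigr => I _.
by rewrite !ffunE; ring.
Qed.

(** The form [f_E] has the sign [+1], since the grading anticommutes with
    Clifford multiplication. *)
Lemma split_fE_clifford vol xy s t :
  split_fE vol (split_clifford xy s) t = split_fE vol s (split_clifford xy t).
Proof.
by rewrite /split_fE grading_clifford split_fNl split_f_clifford opprK.
Qed.

(** The top coefficient of a volume form is nonzero, being the only one. *)
Lemma split_f_neq0 vol : volume_form vol ->
  split_f vol (ext_basis set0) (ext_basis setT) != 0.
Proof.
case=> vol0 hvol; rewrite split_f_sum.
rewrite (bigD1 set0) //= big1 ?addr0 => [|I /negPf I0]; last first.
  by rewrite !ffunE I0 mulr0 mul0r.
rewrite !ffunE eqxx setC0 eqxx !mulr1 mulf_neq0 ?invr_eq0 //.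
  by rewrite signr_eq0.
apply: contraNneq vol0 => volT; apply/eqP/ffunP => I; rewrite ffunE.
apply/eqP; apply: contraPT isT => vI; have cI := hvol I vI.
move: vI; suff -> : I = setT by rewrite volT eqxx.
by apply/eqP; rewrite eqEcard subsetT cardsT card_ord cI leqnn.
Qed.

Lemma grading_ext_basis0 : grading (ext_basis set0) = ext_basis set0.
Proof.
apply/ffunP => K; rewrite !ffunE; case: eqP => [->|_]; last by rewrite mulr0.
by rewrite cards0 mul1r.
Qed.

Lemma split_fE_neq0 vol : volume_form vol ->
  split_fE vol (ext_basis set0) (ext_basis setT) != 0.
Proof. by rewrite /split_fE grading_ext_basis0; apply: split_f_neq0. Qed.

End SplitSpinorForms.

(** * The canonical form *)

Section SplitBasis.
Variables (R : realType) (m : nat).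
Implicit Types (I K L : {set 'I_m}) (i : 'I_m).

Lemma split_clifford_vacuum (y : 'rV[R]_m) :
  split_clifford (0, y) (ext_basis R set0) = 0.
Proof.
apply/ffunP => K; rewrite split_cliffordE [RHS]ffunE !big1 ?mulr0 ?subr0 //.
  move=> i iK; rewrite ffunE; case: eqP => [e|_]; last by rewrite mulr0.
  by move: (in_set0 i); rewrite -e setU11.
by move=> i _; rewrite mxE mulr0 mul0r.
Qed.

Lemma split_clifford0 (s : extalg R m) : split_clifford (0, 0) s = 0.
Proof.
apply/ffunP => K; rewrite split_cliffordE [RHS]ffunE !big1 ?mulr0 ?subr0 //;
  by move=> i _; rewrite mxE mulr0 mul0r.
Qed.

Lemma split_clifford_creation i L : i \notin L ->
  split_clifford (delta_mx 0 i, 0) (ext_basis R L) =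
    (-1) ^+ below L i *: ext_basis R (i |: L).
Proof.
move=> iL; apply/ffunP => K; rewrite split_cliffordE [RHS]ffunE ffunE.
rewrite [X in _ * X]big1 ?mulr0 ?subr0 => [|j _];
  last by rewrite mxE mulr0 mul0r.
have [iK|iK] := boolP (i \in K); last first.
  rewrite big1 => [|j jK].
    case: eqP => [e|_]; last by rewrite scaler0.
    by rewrite e setU11 in iK.
  rewrite mxE eqxx /=; case: eqP => [e|_]; last by rewrite mulr0 mul0r.
  by rewrite -e jK in iK.
rewrite (bigD1 i) //= big1 ?addr0 => [|j /andP [_ /negPf ji]]; last first.
  by rewrite mxE ji andbF mulr0 mul0r.
rewrite mxE !eqxx mulr1 ffunE; have -> : (K :\ i == L) = (K == i |: L).
  by apply/eqP/eqP => [<-|->]; [rewrite setD1K|rewrite setU1K].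
case: eqP => [->|_]; last by rewrite scaler0 mulr0.
by rewrite below_setU1_self.
Qed.

Lemma split_clifford_annihilation i I K : i \notin K ->
  split_clifford (0, delta_mx 0 i) (ext_basis R I) K =
    - 2 * (-1) ^+ below K i * (i |: K == I)%:R.
Proof.
move=> iK; rewrite split_cliffordE big1 ?add0r => [|j _]; last first.
  by rewrite mxE mulr0 mul0r.
rewrite (bigD1 i) //= big1 ?addr0 => [|j /andP [_ /negPf ji]]; last first.
  by rewrite mxE ji andbF mulr0 mul0r.
by rewrite mxE !eqxx mulr1 ffunE -!mulrA mulNr.
Qed.

End SplitBasis.

Section Tensors.
Variables (R : realType) (m : nat) (S2 : vectType R).
Implicit Types (s : extalg R m) (x y : S2).

Lemma tens_is_linear s : linear (@tens R m S2 s).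
Proof.
move=> a x y; apply/ffunP => I; rewrite !ffunE scalerDr !scalerA.
by rewrite mulrC.
Qed.

Lemma tensZl a s x : tens (a *: s) x = a *: tens s x.
Proof. by apply/ffunP => I; rewrite !ffunE scalerA. Qed.

Lemma tens0l x : tens (0 : extalg R m) x = 0.
Proof. by apply/ffunP => I; rewrite !ffunE scale0r. Qed.

Lemma tens_expand (f : {ffun {set 'I_m} -> S2}) :
  f = \sum_I tens (ext_basis R I) (f I).
Proof.
apply/ffunP => K; rewrite sum_ffunE (bigD1 K) //= big1 ?addr0.
  by rewrite !ffunE eqxx scale1r.
by move=> I IK; rewrite !ffunE eq_sym (negPf IK) scale0r.
Qed.

End Tensors.

Section TensorForm.
Variables (R : realType) (V S S2 : vectType R) (rho : 'Hom(V, 'End(S))).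
Variables (h : bilform R S) (h2 : bilform R S2) (m : nat).
Variables (iU iU' : 'Hom('rV[R]_m, V)) (vol : extalg R m).
Variable (h1 : extalg R m -> extalg R m -> R).
Variable (phi : 'Hom({ffun {set 'I_m} -> S2}, S)).
Local Notation eb := (ext_basis R).
Hypothesis irr : irreducible_over rho predT fullv.
Hypothesis hvol : volume_form vol.
Hypothesis h1E : h1 = split_f vol \/ h1 = split_fE vol.
Hypothesis S20 : (fullv : {vspace S2}) != 0%VS.
Hypothesis h2sym : forall s t, h2 s t = h2 t s.
Hypothesis h2pos : forall s, s != 0 -> 0 < h2 s s.
Hypothesis phiK : lker phi = 0%VS.
Hypothesis phiT : limg phi = fullv.
Hypothesis hrho : forall x y I s2, rho (iU x + iU' y) (phi (tens (eb I) s2)) =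
  phi (tens (split_clifford (x, y) (eb I)) s2).
Hypothesis hh : forall s1 s2 t1 t2,
  h (phi (tens s1 s2)) (phi (tens t1 t2)) = h1 s1 t1 * h2 s2 t2.

Lemma tensor_surj s : exists f, s = phi f.
Proof.
have : s \in limg phi by rewrite phiT memvf.
by case/memv_imgP => f _ ->; exists f.
Qed.

(** Bilinear identities on the tensor product are checked on the tensors of
    basis vectors. *)
Lemma tensor_bil_ext (A B : 'End(S)) (a : R) :
  (forall I s2 J t2, h (A (phi (tens (eb I) s2))) (phi (tens (eb J) t2)) =
     a * h (phi (tens (eb I) s2)) (B (phi (tens (eb J) t2)))) ->
  forall s t, h (A s) t = a * h s (B t).
Proof.
move=> hAB s t; have [f ->] := tensor_surj s; have [k ->] := tensor_surj t.
rewrite [f]tens_expand [k]tens_expand !(happ_sum phi) (happ_sum A) (happ_sum B).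
rewrite !bil_suml mulr_sumr.
apply: eq_bigr => I _; rewrite !bil_sumr mulr_sumr; apply: eq_bigr => J _.
exact: hAB.
Qed.

Lemma h1_pairing_neq0 : h1 (eb set0) (eb setT) != 0.
Proof. by case: h1E => ->; [apply: split_f_neq0|apply: split_fE_neq0]. Qed.

Lemma h1_sym : exists eps, eps * eps = 1 /\ forall s t, h1 s t = eps * h1 t s.
Proof.
case: h1E => ->.
  exists ((-1) ^+ (m * m.+1)./2); split; first exact: sign_sq.
  by move=> s t; rewrite split_f_sym.
exists ((-1) ^+ (m * m.+1)./2 * (-1) ^+ m); split; last first.
  by move=> s t; rewrite split_fE_sym.
by rewrite mulrACA !sign_sq mulr1.
Qed.

(** A vector annihilated by [U^*] is the tensor product of the unit of the
    exterior algebra with an element of [S2]. *)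
Lemma vacuum f : (forall y, rho (iU' y) (phi f) = 0) ->
  f = tens (eb set0) (f set0).
Proof.
move=> ann; have fI I : I != set0 -> f I = 0.
  case/set0Pn => i iI.
  have := ann (delta_mx 0 i).
  rewrite -[iU' _]add0r -(happ0 iU) {1}[f]tens_expand !happ_sum.
  under eq_bigr => J _ do rewrite hrho.
  rewrite -happ_sum => /eqP; rewrite -memv_ker phiK memv0.
  move=> /eqP/ffunP/(_ (I :\ i)).
  have iK : i \notin I :\ i by rewrite !inE eqxx.
  rewrite sum_ffunE (bigD1 I) //= big1 ?addr0 => [|J /negPf JI]; last first.
    rewrite ffunE split_clifford_annihilation // setD1K // eq_sym JI.
    by rewrite mulr0 scale0r.
  rewrite [LHS]ffunE [RHS]ffunE split_clifford_annihilation // setD1K // eqxx.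
  rewrite mulr1 => /eqP.
  by rewrite scaler_eq0 mulf_eq0 oppr_eq0 signr_eq0 pnatr_eq0 => /eqP.
apply/ffunP => I; rewrite !ffunE; case: eqP => [->|/eqP I0].
  by rewrite scale1r.
by rewrite scale0r fI.
Qed.

(** The commutant acts on the second factor only: [Z] preserves the vectors
    annihilated by [U^*], and these generate [S] under [U]. *)
Lemma tensor_commutant Z : sign_commutes rho 1 Z ->
  exists Z2 : 'End(S2), forall I s2,
    Z (phi (tens (eb I) s2)) = phi (tens (eb I) (Z2 s2)).
Proof.
move=> cZ.
have [Z2 hZ2] : exists Z2 : 'End(S2), forall s2,
    Z2 s2 = (phi^-1%VF (Z (phi (tens (eb set0) s2)))) set0.
  by apply: linear_hom => a x y; rewrite tens_is_linear !happD !happZ !ffunE.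
exists Z2 => I s2; move: {2}#|I| (erefl #|I|) => n; elim: n I => [|n IH] I cI.
  have -> : I = set0 by apply/eqP; rewrite -cards_eq0 cI.
  have [f Zf] := tensor_surj (Z (phi (tens (eb set0) s2))).
  rewrite hZ2 Zf lker0_lfunK ?phiK // -vacuum // => y.
  rewrite -Zf -[RHS](happ0 Z) -[RHS]scale1r -(happ0 Z).
  have := cZ (iU' y) (phi (tens (eb set0) s2)); rewrite scale1r => <-.
  rewrite scale1r; congr (Z _).
  rewrite -[iU' y]add0r -(happ0 iU) hrho split_clifford_vacuum tens0l happ0.
  by rewrite happ0.
have [i iI] : exists i, i \in I by apply/set0Pn; rewrite -cards_eq0 cI.
have iL : i \notin I :\ i by rewrite !inE eqxx.
have create x2 : phi (tens (eb I) x2) = (-1) ^+ below (I :\ i) i *: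
    rho (iU (delta_mx 0 i)) (phi (tens (eb (I :\ i)) x2)).
  rewrite -[iU _]addr0 -(happ0 iU') hrho split_clifford_creation // tensZl.
  by rewrite happZ scalerA sign_sq scale1r setD1K.
rewrite !create happZ cZ scale1r IH //.
by move: cI; rewrite (cardsD1 i) iI => -[].
Qed.

(** The selfadjoint elements of the commutant are scalars: the operator on [S2]
    induced by such an element is selfadjoint for [h2], so it has a real
    eigenvalue. *)
Lemma tensor_clifford_form tau : tau * tau = 1 ->
  (forall v s t, h (rho v s) t = tau * h s (rho v t)) ->
  exists eps, clifford_form rho h tau eps.
Proof.
move=> tt htau; have [eps [ee h1s]] := h1_sym.
have [x0 x00] : exists x0 : S2, x0 != 0.
  by exists (vpick fullv); rewrite vpick0.
exists eps; split=> //.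
- move=> s t; have [f ->] := tensor_surj s; have [k ->] := tensor_surj t.
  rewrite [f]tens_expand [k]tens_expand !(happ_sum phi) !bil_suml.
  under eq_bigr => I _ do rewrite bil_sumr.
  under [in RHS]eq_bigr => I _ do rewrite bil_sumr.
  rewrite exchange_big mulr_sumr; apply: eq_bigr => J _.
  rewrite mulr_sumr; apply: eq_bigr => I _.
  by rewrite !hh h1s h2sym mulrA.
- apply: (form_nondegenerate irr htau).
  exists (phi (tens (eb set0) x0)), (phi (tens (eb setT) x0)).
  by rewrite hh mulf_neq0 ?h1_pairing_neq0 // gt_eqF // h2pos.
- move=> Z cZ hZ; have [Z2 ZZ2] := tensor_commutant cZ.
  have hZ2 s t : h2 (Z2 s) t = h2 s (Z2 t).
    have := hZ (phi (tens (eb set0) s)) (phi (tens (eb setT) t)).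
    by rewrite !ZZ2 !hh => /(mulfI h1_pairing_neq0).
  have [a [x [xn0 Zx]]] := selfadjoint_eigenvector S20 h2sym h2pos hZ2.
  exists a.
  apply: (commutant_eigenvector irr (s0 := phi (tens (eb set0) x))) => //.
    rewrite -memv_ker phiK memv0; apply: contraNneq xn0.
    by move/ffunP/(_ set0); rewrite !ffunE eqxx scale1r => ->.
  rewrite ZZ2 Zx -happZ; congr (phi _); apply/ffunP => I.
  by rewrite !ffunE !scalerA mulrC.
Qed.

End TensorForm.

Section CanonicalForms.
Variables (R : realType) (p q : nat).
Local Notation V := 'rV[R]_(p + q).
Local Notation g := (@pseudo_euclidean R p q).
Local Notation e i := (delta_mx 0 i : V).
Variables (S : vectType R) (rho : 'Hom(V, 'End(S))).
Hypothesis hS : spinor_module g rho.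
Variable (h : bilform R S).
Let irr := hS.2.

Lemma basis_neq0 i : e i != 0.
Proof.
apply: contraTneq isT => /rowP/(_ i); rewrite !mxE !eqxx => /eqP.
by rewrite oner_eq0.
Qed.

Lemma canonical_definite_form : (0 < p + q)%N -> canonical_definite g rho h ->
  exists tau eps, clifford_form rho h tau eps.
Proof.
move=> n0 [def [hsym hpos hinv]].
have [c cc nc] : exists2 c : R, c * c = 1 & forall i, g (e i) (e i) = c.
  have gE i : g (e i) (e i) = basis_norm R i.
    by rewrite pseudo_euclidean_basis2 eqxx mulr1.
  case: def => def; [exists 1|exists (-1)];
    rewrite ?mulr1 ?mulrNN ?mulr1 // => i;
    have := def _ (memvf (e i)) (basis_neq0 i); rewrite gE /basis_norm;
    case: ifP => // _.
    by rewrite oppr_gt0 ltr10.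
  by rewrite ltr10.
have htau v s t : h (rho v s) t = - c * h s (rho v t).
  rewrite [v]row_sum_delta !happ_sum !sum_lfunE bil_suml bil_sumr mulr_sumr.
  apply: eq_bigr => i _; rewrite !happZ !scale_lfunE bilZl bilZr mulrCA.
  congr (_ * _).
  have ci : g (e i) (e i) = 1 \/ g (e i) (e i) = -1.
    by rewrite nc; apply: sq1_sign.
  rewrite -[in RHS](hinv _ ci) (clifford_sq hS) nc bilZr mulrA.
  by rewrite mulrNN cc mul1r.
exists (- c), 1; split; rewrite ?mulrNN ?mulr1 //.
- by move=> s t; rewrite mul1r.
- move=> s hs0; apply/eqP; apply: contraT => s0.
  by have := hpos s s0; rewrite hs0 ltxx.
- move=> Z cZ hZ.
  have [a [x [x0 Zx]]] :=
    selfadjoint_eigenvector (spinors_neq0 irr) hsym hpos hZ.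
  by exists a; apply: (commutant_eigenvector irr cZ x0 Zx).
Qed.

(** The split case is the tensor product with the one-dimensional spinor
    module [S2 = R], with multiplication as [h2]. *)
Lemma canonical_split_form : canonical_split g rho h ->
  exists tau eps, clifford_form rho h tau eps.
Proof.
case=> m [iU [iU' [vol [phi [[_ _ _ _ sumV] hvol [phiK phiT] hrho hh]]]]].
have [h2 h2E] : exists h2 : bilform R R^o, forall x y, h2 x y = x * y.
  have mulh (x : R^o) : exists f : 'Hom(R^o, R^o), forall y, f y = x * y.
    apply: linear_hom => a y z; rewrite mulrDr; congr (_ + _).
    by rewrite mulrCA.
  have /choice [k hk] := mulh.
  have [h2 hh2] : exists h2 : bilform R R^o, forall x, h2 x = k x.
    apply: linear_hom => a x y; apply/lfunP => z.
    by rewrite add_lfunE scale_lfunE !hk mulrDl -mulrA.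
  by exists h2 => x y; rewrite hh2 hk.
have tE s (c : R^o) : tens s c = c *: s.
  by apply/ffunP => I; rewrite !ffunE [RHS]mulrC.
have htau v s t : h (rho v s) t = 1 * h s (rho v t).
  have : v \in (limg iU + limg iU' + 0)%VS by rewrite sumV memvf.
  rewrite addv0.
  case/memv_addP => [_ /memv_imgP [x _ ->] [_ /memv_imgP [y _ ->] ->]].
  have [f ->] := tensor_surj phiT s; have [k ->] := tensor_surj phiT t.
  by rewrite !hrho !hh split_fE_clifford mul1r.
have [|||||||eps hf] := @tensor_clifford_form R V S R^o rho h h2 m iU iU' vol
  (split_fE vol) phi irr hvol _ _ _ _ phiK phiT _ _ 1 _ htau.
- by right.
- by rewrite -dimv_eq0 dimvf.
- by move=> x y; rewrite !h2E mulrC.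
- by move=> x x0; rewrite h2E -expr2 exprn_even_gt0.
- move=> x y I c; by rewrite !tE !(happZ phi) happZ hrho.
- by move=> s1 s2 t1 t2; rewrite !tE !(happZ phi) bilZl bilZr hh h2E; ring.
- by rewrite mulr1.
- by exists 1, eps.
Qed.

Lemma canonical_mixed_form : canonical_mixed g rho h ->
  exists tau eps, clifford_form rho h tau eps.
Proof.
case=> m [iU [iU' [V2 [S2 [rho2 [h2 [vol [h1]]]]]]]].
case=> [tau1 [iota1 [tau2 [phi]]]].
case=> [[_ _ _ [_ _ _ _ sumV]] [[_ [S20 _ _]] [h2sym h2pos _]]].
case=> hvol h1E [t1E htau1] hiota [[t2E htau2] t21] [phiK phiT hrho] hh.
have homI (I : {set 'I_m}) : homogeneous #|I| (ext_basis R I).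
  by move=> K; rewrite ffunE; have [-> | _] := eqVneq K I; rewrite ?eqxx.
have hrho1 x y I s2 : rho (iU x + iU' y) (phi (tens (ext_basis R I) s2)) =
    phi (tens (split_clifford (x, y) (ext_basis R I)) s2).
  have := hrho x y 0 _ _ s2 (homI I); rewrite !linear0 addr0 => ->.
  rewrite zero_lfunE; have -> : tens (ext_basis R I) (0 : S2) = 0.
    by apply/ffunP => K; rewrite !ffunE scaler0.
  by rewrite happ0 scaler0 addr0.
have hrho2 (w : subvs_of V2) I s2 :
    rho (vsval w) (phi (tens (ext_basis R I) s2)) =
    (-1) ^+ #|I| *: phi (tens (ext_basis R I) (rho2 w s2)).
  have := hrho 0 0 w _ _ s2 (homI I); rewrite !happ0 !add0r => ->.
  by rewrite split_clifford0 tens0l happ0 add0r.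
(* Multiplication by [V2] has the sign [iota1 * tau2 = tau1]: the degrees of [e_I] and
   [e_J] have the parity prescribed by [iota1] unless [h1] vanishes on them. *)
have parity (I J : {set 'I_m}) :
    (-1) ^+ #|I| * iota1 * h1 (ext_basis R I) (ext_basis R J)
    = (-1) ^+ #|J| * h1 (ext_basis R I) (ext_basis R J).
  have ev (K : {set 'I_m}) : ~~ odd #|K| -> even_spinor (ext_basis R K).
    by move=> oK L /homI ->.
  have od (K : {set 'I_m}) : odd #|K| -> odd_spinor (ext_basis R K).
    by move=> oK L /homI ->.
  rewrite -[in LHS]signr_odd -[in RHS]signr_odd.
  case: hiota => -[-> hio]; have [oI|eI] := boolP (odd #|I|);
    have [oJ|eJ] := boolP (odd #|J|);
    rewrite ?mulr1 ?mulrN1 ?expr0 ?expr1 ?opprK //.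
  - by have [_ ->] := hio _ _ (ev J eJ) (od I oI); rewrite !mulr0.
  - by have [-> _] := hio _ _ (ev I eI) (od J oJ); rewrite !mulr0.
  - by rewrite hio ?mulr0 //; right; split; apply: od.
  - by rewrite hio ?mulr0 //; left; split; apply: ev.
have tt : tau1 * tau1 = 1.
  by case: t1E => ->; rewrite ?mulrNN mulr1.
have htau v s t : h (rho v s) t = tau1 * h s (rho v t).
  have : v \in (limg iU + limg iU' + V2)%VS by rewrite sumV memvf.
  case/memv_addP => [_ /memv_addP [_ /memv_imgP [x _ ->]
    [_ /memv_imgP [y _ ->] ->]] [w wV2 ->]].
  apply: (tensor_bil_ext phiT) => I s2 J t2.
  have -> : w = vsval (Subvs wV2) by [].
  move: (Subvs wV2) => u; rewrite !(happD rho (_ + _)) !add_lfunE !bilE.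
  rewrite !hrho1 !hrho2 !bilE !hh htau1 mulrDr htau2 -mulrA; congr (_ + _).
  have := parity I J; rewrite t21.
  move: ((-1) ^+ _) ((-1) ^+ _) (h1 _ _) (h2 _ _) => a b c d e.
  by transitivity (b * iota1 * c * (tau1 * d)); [|rewrite e]; ring.
have [eps hf] := tensor_clifford_form irr hvol h1E S20 h2sym h2pos phiK phiT
  hrho1 hh tt htau.
by exists tau1, eps.
Qed.

Lemma canonical_clifford_form : (0 < p + q)%N -> canonical_form g rho h ->
  exists tau eps, clifford_form rho h tau eps.
Proof.
move=> n0 [|can|can]; first exact: canonical_definite_form.
  exact: canonical_split_form.
exact: canonical_mixed_form.
Qed.

End CanonicalForms.

(** * The spanning theorem *)

Theorem corollary6p3 (R : realType) (p q : nat) (hpq : (0 < p + q)%N)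
    (S : vectType R) (rho : 'Hom('rV[R]_(p + q), 'End(S)))
    (hS : spinor_module (@pseudo_euclidean R p q) rho)
    (Sp Sm : {vspace S})
    (hSpm : Cl0_reducible rho -> semispinor_decomposition rho Sp Sm)
    (h : bilform R S)
    (hh : canonical_form (@pseudo_euclidean R p q) rho h) :
  (forall A : 'End(S), schur_algebra rho A -> admissible rho h Sp Sm A ->
     so_equivariant rho (j_rho rho (h_form h A)) /\
     injective (j_rho rho (h_form h A))) /\
  (forall j : 'Hom('rV[R]_(p + q), bilform R S), so_equivariant rho j ->
     exists (N : nat) (c : 'I_N -> R) (A : 'I_N -> 'End(S)),
       (forall k, schur_algebra rho (A k) /\ admissible rho h Sp Sm (A k)) /\
       forall v, j v = \sum_(k < N) c k *: j_rho rho (h_form h (A k)) v).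
Proof.
have [tau [eps hf]] := canonical_clifford_form hS hpq hh.
split=> [A sA aA|j eqj]; first exact: (admissible_embedding hS hf sA aA).
exact: (equivariant_combination hS hSpm hf hpq eqj).
Qed.
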